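(* Let $F$ be a perfect field of characteristic $p\neq 0$, let $(L,[p])$ be a finite dimensional restricted Lie algebra over $F$, and let $S$ be a $[p]$-subalgebra of $L$. Let $C$ be a simple cluster of characters of $L$ which restricts simply to $S$, and let $W$ be a finite dimensional amenable $S$-module with $\mathrm{Cl}(W)=C|S=\{c|_S\mid c\in C\}$. Let $\bar V=\bigoplus_{c\in C}\bar V_c$, where $\bar V_c=u(\bar L,c)\otimes_{u(\bar S,c)}\bar W_c$ is the $c$-induced $\bar L$-module. Let $v\in\bar V$ be invariant under the action of $\mathrm{Aut}(\bar F/F)$ on $\bar V$. Then $xv$ is invariant for all $x\in L$.
   Context: Let $\bar F$ be the algebraic closure of $F$; for a restricted Lie algebra $K$ over $F$ put $\bar K=\bar F\otimes_FK$, which is a restricted Lie algebra with the $p$-operation extending that of $K$; for a $K$-module $M$ put $\bar M=\bar F\otimes_F M$, a $\bar K$-module. $\mathrm{Aut}(\bar F/F)$ is the group of automorphisms of $\bar F$ fixing every element of $F$. A $[p]$-subalgebra is a Lie subalgebra closed under $x\mapsto x^{[p]}$. Characters and clusters. For a restricted Lie algebra $K$ over $F$ (here $K=L$ or $S$), a character of $K$ is an $F$-linear map $c:K\to\bar F$; its $\bar F$-linear extension $\bar K\to\bar F$ is denoted by the same letter. A $\bar K$-module $M$ with action $\rho$ has character $c$ if $(\rho(x)^p-\rho(x^{[p]}))v=c(x)^pv$ for all $x\in K$, $v\in M$. Every irreducible finite dimensional $\bar K$-module has a unique character. For $\alpha\in\mathrm{Aut}(\bar F/F)$ the conjugate $c^\alpha$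 is given by $c^\alpha(x)=\alpha(c(x))$ for $x\in K$. A cluster is a finite set of characters containing all conjugates of its members; it is simple if it is a single conjugacy class. The cluster $\mathrm{Cl}(M)$ of a finite dimensional $K$-module $M$ is the set of characters of the composition factors of the $\bar K$-module $\bar M$. A cluster $C$ of characters of $L$ restricts simply to $S$ if distinct members of $C$ have distinct restrictions to $S$. Components and amenability. Let $W$ be a finite dimensional $S$-module, and $\phi_s=\rho(s)^p-\rho(s^{[p]})$ for $s\in S$. For $c\in\mathrm{Cl}(W)$, $\bar W_c=\{w\in\bar W\mid \text{for some } r,\ (\phi_s-c(s)^p1)^rw=0 \text{ for all } s\in S\}$; these are $\bar S$-submodules and $\bar W=\bigoplus_{c\in \mathrm{Cl}(W)}\bar W_c$. $W$ is amenable if $\bar W_c$ has character $c$ for all $c\in\mathrm{Cl}(W)$. For $c\in C$, $\bar W_c$ denotes $\bar W_{c|_S}$, and $w\in\bar W$ is written $w=\sum_{c\in C}w_c$ with $w_c\in\bar W_c$. Induced modules. $u(\bar L,c)$ is the $c$-reduced enveloping algebra, the quotient of the universal enveloping algebra $U(\bar L)$ by the ideal generated by all $x^p-x^{[p]}-c(x)^p1$, $x\in\bar L$; $u(\bar S,c)$ is defined in the same way using $c|_{\bar S}$. Since $\bar W_c$ has character $c|_S$, it is a $u(\bar S,c)$-module. Action of $\mathrm{Aut}(\bar F/F)$ on $\bar V$. Let $\{e_1,\dots,e_n\}$ be a cobasis of $S$ in $L$ (a basis of a vector space complement of $S$ in $L$), and $\{b^1,\dots,b^k\}$ a basis of $W$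 over $F$. For $r=(r_1,\dots,r_n)$ with $0\le r_j\le p-1$, put $e(r)=e_1^{r_1}\cdots e_n^{r_n}$, and for $w\in\bar W$ let $e(r)\otimes w$ denote $\sum_{c\in C}e(r)\otimes w_c\in\bar V$ (where in the summand indexed by $c$, $e(r)$ is computed in $u(\bar L,c)$ and the tensor product is over $u(\bar S,c)$). The elements $e(r)\otimes b^i$ form an $\bar F$-basis of $\bar V$. An automorphism $\alpha\in \mathrm{Aut}(\bar F/F)$ acts on $\bar V$ by $\sum_{r,i}\lambda_{r,i}\,e(r)\otimes b^i\mapsto\sum_{r,i}\alpha(\lambda_{r,i})\,e(r)\otimes b^i$. An element of $\bar V$ is invariant if it is fixed by all $\alpha\in\mathrm{Aut}(\bar F/F)$; equivalently (as $F$ is perfect), if it is an $F$-linear combination of the $e(r)\otimes b^i$. *)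

(* Defs.v *)
From HB Require Import structures.
From mathcomp Require Import all_boot all_algebra finmap.
From mathcomp Require Import boolp classical_sets.
From mathcomp Require Import monalg.

Set Implicit Arguments.
Unset Strict Implicit.
Unset Printing Implicit Defensive.

Import GRing.Theory.

Local Open Scope ring_scope.
Local Open Scope quotient_scope.

Section QuotientModule.
Variables (k : pzRingType) (V : lmodType k) (X : V -> Prop).

Inductive spanned : V -> Prop :=
| Spanned0 : spanned 0
| SpannedS a x v : X x -> spanned v -> spanned (a *: x + v).

Lemma spannedD u v : spanned u -> spanned v -> spanned (u + v).
Proof.
move=> + hv; elim=> [|a x {}u Xx _ ih]; first by rewrite add0r.
by rewrite -addrA; apply: SpannedS.
Qed.

Lemma spannedZ a u : spanned u -> spanned (a *: u).
Proof.
elim=> [|b x {}u Xx _ ih]; first by rewrite scaler0; apply: Spanned0.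
by rewrite scalerDr scalerA; apply: SpannedS.
Qed.

Definition in_span : {pred V} := fun v => `[< spanned v >].

Fact in_span_zmod_closed : zmod_closed in_span.
Proof.
split=> [|u v]; first exact/asboolP/Spanned0.
move=> /asboolP hu /asboolP hv; apply/asboolP; apply: spannedD hu _.
by rewrite -scaleN1r; apply: spannedZ.
Qed.
HB.instance Definition _ :=
  GRing.isZmodClosed.Build V in_span in_span_zmod_closed.

(* The quotient of V by the submodule spanned by X. *)
Definition quotmod := Quotient.quot in_span.
HB.instance Definition _ := Choice.on quotmod.
HB.instance Definition _ := GRing.Zmodule.on quotmod.

Definition qmod_pi (v : V) : quotmod := \pi_(Quotient.quot in_span) v.
Definition qmod_repr (q : quotmod) : V := repr q.

Lemma qmod_reprK : cancel qmod_repr qmod_pi.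
Proof. exact: reprK. Qed.

Lemma qmod_piP u v : qmod_pi u = qmod_pi v <-> spanned (u - v).
Proof.
have -> : (qmod_pi u = qmod_pi v) <-> (u - v) \in in_span.
  by rewrite Quotient.idealrBE; split=> /eqP.
by split=> /asboolP.
Qed.

Lemma qmod_pi_repr v : spanned (qmod_repr (qmod_pi v) - v).
Proof. by apply/qmod_piP; rewrite qmod_reprK. Qed.

Fact qmod_pi_zmod_morphism : zmod_morphism qmod_pi.
Proof. by move=> u v; rewrite /qmod_pi !piE. Qed.
HB.instance Definition _ :=
  GRing.isZmodMorphism.Build V quotmod qmod_pi qmod_pi_zmod_morphism.

Definition qmod_scale a (q : quotmod) := qmod_pi (a *: qmod_repr q).

Fact qmod_piZ a v : qmod_pi (a *: v) = qmod_scale a (qmod_pi v).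
Proof.
by apply/esym/qmod_piP; rewrite -scalerBr; apply/spannedZ/qmod_pi_repr.
Qed.

Fact qmod_scaleA a b q :
  qmod_scale a (qmod_scale b q) = qmod_scale (a * b) q.
Proof. by rewrite -[q]qmod_reprK -!qmod_piZ scalerA. Qed.
Fact qmod_scale1 : left_id 1 qmod_scale.
Proof. by move=> q; rewrite -[q]qmod_reprK -qmod_piZ scale1r. Qed.
Fact qmod_scaleDr : right_distributive qmod_scale +%R.
Proof.
move=> a q r; rewrite -[q]qmod_reprK -[r]qmod_reprK -raddfD -!qmod_piZ.
by rewrite scalerDr raddfD.
Qed.
Fact qmod_scaleDl q : {morph qmod_scale^~ q : a b / a + b}.
Proof.
by move=> a b; rewrite -[q]qmod_reprK -!qmod_piZ scalerDl raddfD.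
Qed.
HB.instance Definition _ := GRing.Zmodule_isLmodule.Build k quotmod
  qmod_scaleA qmod_scale1 qmod_scaleDr qmod_scaleDl.

Fact qmod_pi_scalable : scalable qmod_pi.
Proof. exact: qmod_piZ. Qed.
HB.instance Definition _ :=
  GRing.isScalable.Build k V quotmod *:%R qmod_pi qmod_pi_scalable.

End QuotientModule.

Section QuotientRing.
Variables (R : pzRingType) (X : R -> Prop).

(* The left ideal spanned by the x * b is the two-sided ideal generated by X. *)
Variant ideal_gen : R^o -> Prop :=
| IdealGen x b : X x -> ideal_gen (x * b : R).

Definition quotring := quotmod ideal_gen.
HB.instance Definition _ := GRing.Zmodule.on quotring.

Definition qring_pi : R -> quotring := @qmod_pi R R^o ideal_gen.
Definition qring_repr : quotring -> R := @qmod_repr R R^o ideal_gen.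

Lemma qring_reprK : cancel qring_repr qring_pi.
Proof. exact: qmod_reprK. Qed.

Fact qring_pi_zmod_morphism : zmod_morphism qring_pi.
Proof. exact: (@qmod_pi_zmod_morphism R R^o). Qed.
HB.instance Definition _ :=
  GRing.isZmodMorphism.Build R quotring qring_pi qring_pi_zmod_morphism.

Lemma ideal_mull (c u : R) :
  @spanned R R^o ideal_gen u -> @spanned R R^o ideal_gen (c * u).
Proof. exact: spannedZ. Qed.

Lemma ideal_mulr (c u : R) :
  @spanned R R^o ideal_gen u -> @spanned R R^o ideal_gen (u * c).
Proof.
elim=> [|a _ v [x b Xx] _ ih]; first by rewrite mul0r; apply: Spanned0.
have -> : (a *: (x * b : R^o) + v : R) * c = a * (x * (b * c)) + v * c.
  by rewrite mulrDl -!mulrA.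
exact: (@SpannedS R R^o).
Qed.

Definition qring_mul (q r : quotring) := qring_pi (qring_repr q * qring_repr r).

Fact qring_piM u v : qring_pi (u * v) = qring_mul (qring_pi u) (qring_pi v).
Proof.
apply/esym/qmod_piP; set u' := qring_repr _; set v' := qring_repr _.
have -> : u' * v' - u * v = (u' - u) * v' + u * (v' - v).
  by rewrite mulrBl mulrBr addrA subrK.
by apply: (@spannedD R R^o); [apply: ideal_mulr | apply: ideal_mull];
   apply: (@qmod_pi_repr R R^o).
Qed.

Fact qring_mulA : associative qring_mul.
Proof.
move=> x y z; rewrite -[x]qring_reprK -[y]qring_reprK -[z]qring_reprK.
by rewrite -!qring_piM mulrA.
Qed.
Fact qring_mul1 : left_id (qring_pi 1) qring_mul.
Proof. by move=> x; rewrite -[x]qring_reprK -qring_piM mul1r. Qed.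
Fact qring_mulr1 : right_id (qring_pi 1) qring_mul.
Proof. by move=> x; rewrite -[x]qring_reprK -qring_piM mulr1. Qed.
Fact qring_mulDl : left_distributive qring_mul +%R.
Proof.
move=> x y z; rewrite -[x]qring_reprK -[y]qring_reprK -[z]qring_reprK.
by rewrite -raddfD -!qring_piM mulrDl raddfD.
Qed.
Fact qring_mulDr : right_distributive qring_mul +%R.
Proof.
move=> x y z; rewrite -[x]qring_reprK -[y]qring_reprK -[z]qring_reprK.
by rewrite -raddfD -!qring_piM mulrDr raddfD.
Qed.
HB.instance Definition _ := GRing.Zmodule_isPzRing.Build quotring
  qring_mulA qring_mul1 qring_mulr1 qring_mulDl qring_mulDr.

Fact qring_pi_monoid_morphism : monoid_morphism qring_pi.
Proof. by split=> // x y; apply: qring_piM. Qed.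
HB.instance Definition _ :=
  GRing.isMonoidMorphism.Build R quotring qring_pi qring_pi_monoid_morphism.

End QuotientRing.

(* Unital associative k-algebras. The library's algTypes are nonzero rings, *)
(* whereas the algebras below are defined as quotients, whose nontriviality *)
(* is a theorem (Poincare-Birkhoff-Witt).                                   *)
Structure assocAlg (k : fieldType) := AssocAlg {
  alg_ring :> pzRingType;
  alg_scal : {rmorphism k -> alg_ring};
  alg_scalC : forall a x, alg_scal a * x = x * alg_scal a
}.
Arguments alg_scal {k} A : rename.

Section QuotientAlgebra.
Variables (k : fieldType) (A : assocAlg k) (X : A -> Prop).

Fact quotalg_scalC a (x : quotring X) :
  (qring_pi X \o alg_scal A) a * x = x * (qring_pi X \o alg_scal A) a.
Proof. by rewrite -[x]qring_reprK /= -!rmorphM alg_scalC. Qed.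

Definition quotalg := AssocAlg quotalg_scalC.

End QuotientAlgebra.

Section FreeAlgebra.
Variables (k : fieldType) (K : choiceType).

Fact free_scalC a (x : {malg k[{fmonom K}]}) :
  @malgC {fmonom K} k a * x = x * @malgC {fmonom K} k a.
Proof.
rewrite /GRing.mul /= fgmulUg fgmulgU.
by apply: eq_bigr => i _; rewrite mul1m mulm1 mulrC.
Qed.

Definition freealg : assocAlg k := AssocAlg free_scalC.

Definition free_gen (x : K) : {malg k[{fmonom K}]} := << fmu x >>.

Definition free_hom (A : assocAlg k) (h : K -> A)
    (g : {malg k[{fmonom K}]}) : A :=
  \sum_(m <- msupp g) alg_scal A g@_m * \prod_(x <- (m : seq K)) h x.

(* The action on N of the free algebra such that x in K acts as h x. *)
Definition free_act (N : lmodType k) (h : K -> N -> N)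
    (g : {malg k[{fmonom K}]}) (v : N) : N :=
  \sum_(m <- msupp g) g@_m *: foldr h v (m : seq K).

End FreeAlgebra.

Section TensorProduct.
Variables (k : fieldType) (A : assocAlg k) (B : Type) (M : lmodType k).
Variables (f : B -> A) (act : B -> M -> M).

Variant tensor_rel : {malg k[(A * M)%type]} -> Prop :=
| TensorDl a a' m :
    tensor_rel (<< (a + a', m) >> - << (a, m) >> - << (a', m) >>)
| TensorDr a m m' :
    tensor_rel (<< (a, m + m') >> - << (a, m) >> - << (a, m') >>)
| TensorZ l a m :
    tensor_rel (<< (alg_scal A l * a, m) >> - l *: << (a, m) >>)
| TensorB a b m :
    tensor_rel (<< (a * f b, m) >> - << (a, act b m) >>).

(* For a homomorphism of algebras f : B -> A and a left B-module M whose     *)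
(* action is act, the left A-module A (x)_B M.                               *)
Definition tensor := quotmod tensor_rel.
HB.instance Definition _ := GRing.Lmodule.on tensor.

Definition pure (a : A) (m : M) : tensor := qmod_pi tensor_rel << (a, m) >>.

(* The sum is compatible with the relations, so that the choice of a         *)
(* representative of t is irrelevant.                                        *)
Definition tensor_act (a : A) (t : tensor) : tensor :=
  \sum_(x <- msupp (qmod_repr t)) (qmod_repr t)@_x *: pure (a * x.1) x.2.

End TensorProduct.

Section RestrictedLie.
Variables (p : nat) (k : fieldType) (K : lmodType k).
Variables (br : K -> K -> K) (pm : K -> K).

(* The coefficient of t^j in ad(tx + y)^m (x), an element of K[t]. *)
Fixpoint ad_coef (x y : K) (m j : nat) : K :=
  match m with
  | 0 => if j is 0 then x else 0
  | m'.+1 => br y (ad_coef x y m' j) +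
             (if j is j'.+1 then br x (ad_coef x y m' j') else 0)
  end.

(* The s_i of (x + y)^[p] = x^[p] + y^[p] + \sum_(0 < i < p) s_i(x, y):      *)
(* i s_i(x, y) is the coefficient of t^(i - 1) in ad(tx + y)^(p - 1) (x).    *)
Definition jacobson_s (x y : K) (i : nat) : K :=
  i%:R^-1 *: ad_coef x y p.-1 i.-1.

Record restricted_lie : Prop := RestrictedLie {
  lie_linearl : forall y, linear (br^~ y);
  lie_linearr : forall x, linear (br x);
  lie_alt : forall x, br x x = 0;
  lie_jacobi : forall x y z, br x (br y z) + br y (br z x) + br z (br x y) = 0;
  pmap_ad : forall x y, br (pm x) y = iter p (br x) y;
  pmapZ : forall a x, pm (a *: x) = a ^+ p *: pm x;
  pmapD : forall x y,
    pm (x + y) = pm x + pm y + \sum_(1 <= i < p) jacobson_s x y i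
}.

Record lie_module (M : lmodType k) (rho : K -> M -> M) : Prop := LieModule {
  lmod_linearl : forall w, linear (rho^~ w);
  lmod_linearr : forall x, linear (rho x);
  lmod_br : forall x y w, rho (br x y) w = rho x (rho y w) - rho y (rho x w)
}.

Definition phi (T : Type) (M : zmodType) (q : T -> T) (rho : T -> M -> M)
  (x : T) (w : M) : M := iter p (rho x) w - rho (q x) w.

Variant uea_rel : freealg k K -> Prop :=
| UeaLinear a x y :
    uea_rel (free_gen k (a *: x + y)
             - (alg_scal (freealg k K) a * free_gen k x + free_gen k y))
| UeaBracket x y :
    uea_rel (free_gen k x * free_gen k y - free_gen k y * free_gen k x
             - free_gen k (br x y)).

Definition uea : assocAlg k := quotalg uea_rel.
Definition uea_gen (x : K) : uea := qring_pi uea_rel (free_gen k x).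

Variables (c : K -> k).

Variant reduced_rel : uea -> Prop :=
| ReducedRel x :
    reduced_rel (uea_gen x ^+ p - uea_gen (pm x) - alg_scal uea (c x ^+ p)).

Definition reduced : assocAlg k := quotalg reduced_rel.
Definition reduced_gen (x : K) : reduced := qring_pi reduced_rel (uea_gen x).

(* When the relations defining the reduced enveloping algebra hold for h,    *)
(* that is, when h is a homomorphism (resp. an action) of Lie algebras with  *)
(* h(x)^p - h(x^[p]) = c(x)^p, these are its extensions to the reduced       *)
(* enveloping algebra; they do not depend on the lift of b to the free       *)
(* algebra on K.                                                             *)
Definition reduced_hom (A : assocAlg k) (h : K -> A) (b : reduced) : A :=
  free_hom h (qring_repr (qring_repr b)).
Definition reduced_act (N : lmodType k) (h : K -> N -> N) (b : reduced) :
  N -> N := free_act h (qring_repr (qring_repr b)).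

End RestrictedLie.

Section BaseChange.
Variables (F Fbar : fieldType) (iota : {rmorphism F -> Fbar}).

(* Fbar (x)_F K, in the coordinates relative to the F-basis vbasis {:K}. *)
Definition ext (K : vectType F) : Type := 'rV[Fbar]_(\dim {:K}).
HB.instance Definition _ (K : vectType F) := Vector.on (ext K).

(* x |-> 1 (x) x *)
Definition emb (K : vectType F) (x : K) : ext K := 
  \row_i iota (coord (vbasis {:K}) i x).

(* The Fbar-linear extension of an F-linear map g. *)
Definition ext_lin (K : vectType F) (N : lmodType Fbar) (g : K -> N)
  (u : ext K) : N := \sum_i u 0 i *: g (vbasis {:K})`_i.

(* The Fbar-bilinear extension of an F-bilinear map g. *)
Definition ext_bilin (K M N : vectType F) (g : K -> M -> N)
  (u : ext K) (v : ext M) : ext N :=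
  ext_lin (fun x => ext_lin (fun y => emb (g x y)) v) u.

Definition is_ext_pmap (p : nat) (K : vectType F) (br : K -> K -> K)
    (pm : K -> K) (pmb : ext K -> ext K) : Prop :=
  restricted_lie p (ext_bilin br) pmb /\ forall x, pmb (emb x) = emb (pm x).

Definition algebraic_closure : Prop :=
  GRing.closed_field_axiom Fbar /\ forall z, algebraicOver iota z.

Definition perfect (p : nat) : Prop := forall x : F, exists y, y ^+ p = x.

Definition galois_aut (alpha : {rmorphism Fbar -> Fbar}) : Prop :=
  bijective alpha /\ forall a, alpha (iota a) = iota a.

Definition is_character (K : vectType F) (c : K -> Fbar) : Prop :=
  linear_for (iota \; *%R) c.

Definition char_ext (K : vectType F) (c : K -> Fbar) : ext K -> Fbar :=
  @ext_lin K Fbar^o c.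

Definition cluster (K : vectType F) (C : {fset (K -> Fbar)}) : Prop :=
  (forall c, c \in C -> is_character c) /\
  (forall alpha c, galois_aut alpha -> c \in C -> alpha \o c \in C).

Definition simple_cluster (K : vectType F) (C : {fset (K -> Fbar)}) : Prop :=
  cluster C /\
  exists2 c, c \in C &
    forall d, d \in C -> exists2 alpha, galois_aut alpha & d = alpha \o c.

Definition char_res (L : vectType F) (S : {vspace L}) (c : L -> Fbar) :
  subvs_of S -> Fbar := c \o vsval.

Arguments char_res {L} S c.

Definition restricts_simply (L : vectType F) (S : {vspace L})
    (C : {fset (L -> Fbar)}) : Prop :=
  {in C &, injective (char_res S)}.

Section Module.
Variables (p : nat) (K : vectType F) (pm : K -> K).
Variables (M : vectType F) (rho : K -> M -> M).

Definition phi_ext : K -> ext M -> ext M :=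
  phi p pm (fun x => ext_bilin rho (emb x)).

Definition submodule (U : {vspace ext M}) : Prop :=
  forall x u, u \in U -> ext_bilin rho x u \in U.

Definition irreducible_factor (U V : {vspace ext M}) : Prop :=
  [/\ (U <= V)%VS, U <> V &
      forall T, submodule T -> (U <= T <= V)%VS -> T = U \/ T = V].

Definition composition_series (m : nat) (U : nat -> {vspace ext M}) : Prop :=
  [/\ U 0 = 0%VS, U m = fullv,
      forall i, (i <= m)%N -> submodule (U i) &
      forall i, (i < m)%N -> irreducible_factor (U i) (U i.+1)].

(* The module V / U has character c. *)
Definition factor_has_character (c : K -> Fbar) (U V : {vspace ext M}) : Prop :=
  forall x v, v \in V -> phi_ext x v - c x ^+ p *: v \in U.

Definition module_cluster (c : K -> Fbar) : Prop :=
  is_character c /\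
  exists m U i, [/\ composition_series m U, (i < m)%N &
                    factor_has_character c (U i) (U i.+1)].

Section Component.
Variable c : K -> Fbar.

Definition phi_shift (s : K) (w : ext M) : ext M :=
  phi_ext s w - c s ^+ p *: w.

Definition in_component : {pred ext M} :=
  fun w => `[< exists r, forall s, iter r (phi_shift s) w = 0 >].

Fact emb_act_linear x : linear (ext_bilin rho (emb x)).
Proof.
move=> a u v; rewrite /ext_bilin /ext_lin scaler_sumr -big_split /=.
apply: eq_bigr => i _; rewrite scalerA mulrC -scalerA -scalerDr; congr (_ *: _).
rewrite scaler_sumr -big_split /=; apply: eq_bigr => j _.
by rewrite !mxE scalerDl scalerA.
Qed.

Fact iter_linear (f : ext M -> ext M) : linear f -> forall r, linear (iter r f).
Proof. by move=> lf; elim=> [//|r ih] a u v; rewrite !iterS ih lf. Qed.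

Fact phi_shift_linear s : linear (phi_shift s).
Proof.
move=> a u v; rewrite /phi_shift /phi_ext /phi.
rewrite (iter_linear (emb_act_linear s)) (emb_act_linear (pm s)).
rewrite !scalerBr [c s ^+ p *: _]scalerDr !scalerA [c s ^+ p * a]mulrC.
by rewrite !opprD (addrACA (a *: iter p _ u)) [LHS]addrACA.
Qed.

Fact in_component_closed : subsemimod_closed in_component.
Proof.
have lin r s := iter_linear (phi_shift_linear s) r.
have lin0 r s : iter r (phi_shift s) 0 = 0.
  by have := lin r s (-1) 0 0; rewrite !scaleN1r !addNr.
have mono r r' s w : iter r (phi_shift s) w = 0 ->
    iter (r' + r) (phi_shift s) w = 0.
  by rewrite iterD => ->.
split; first split.
- by apply/asboolP; exists 0%N => s.
- move=> u v /asboolP[r hu] /asboolP[r' hv]; apply/asboolP.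
  exists (r + r')%N => s; rewrite -[u]scale1r lin (mono r' r s v (hv s)).
  by rewrite addnC (mono r r' s u (hu s)) scaler0 add0r.
- move=> a u /asboolP[r hu]; apply/asboolP; exists r => s.
  by rewrite -[a *: u]addr0 lin hu lin0 scaler0 addr0.
Qed.
HB.instance Definition _ :=
  GRing.isSubmodClosed.Build Fbar (ext M) in_component in_component_closed.

Record component := Component {
  comp_val : ext M;
  _ : comp_val \in in_component
}.
HB.instance Definition _ := [isSub for comp_val].
HB.instance Definition _ := [Choice of component by <:].
HB.instance Definition _ := [SubChoice_isSubLmodule of component by <:].

(* The action on the component of x in Fbar (x) K. The component is stable,  *)
(* so that the default value of insubd is not used.                          *)
Definition comp_act (x : ext K) (w : component) : component :=
  insubd (0 : component) (ext_bilin rho x (comp_val w)).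

End Component.

Definition amenable : Prop :=
  forall c, module_cluster c ->
  forall w, w \in in_component c -> forall s, phi_ext s w = c s ^+ p *: w.

End Module.
End BaseChange.

Arguments char_res {F Fbar L} S c.

Section Induced.
Variables (F Fbar : fieldType) (iota : {rmorphism F -> Fbar}) (p : nat).
Variables (L : vectType F) (br : L -> L -> L) (pm : L -> L) (S : {vspace L}).

Local Notation ext := (ext Fbar).

Definition p_subalgebra : Prop :=
  (forall x y, x \in S -> y \in S -> br x y \in S) /\
  (forall x, x \in S -> pm x \in S).

(* The vsproj are the identity when S is a [p]-subalgebra. *)
Definition sub_br (s t : subvs_of S) : subvs_of S :=
  vsproj S (br (vsval s) (vsval t)).
Definition sub_pm (s : subvs_of S) : subvs_of S := vsproj S (pm (vsval s)).

Variables (pmLb : ext L -> ext L) (pmSb : ext (subvs_of S) -> ext (subvs_of S)).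
Variables (W : vectType F) (rho : subvs_of S -> W -> W).

Section InducedComponent.
Variable c : L -> Fbar.

Definition uL : assocAlg Fbar :=
  reduced p (ext_bilin iota br) pmLb (char_ext c).
Definition uS : assocAlg Fbar :=
  reduced p (ext_bilin iota sub_br) pmSb (char_ext (char_res S c)).

Definition uL_gen (x : ext L) : uL := reduced_gen _ _ _ _ x.

Definition ext_incl (s : ext (subvs_of S)) : ext L :=
  ext_lin (fun t => emb iota (vsval t)) s.

Definition uS_to_uL (b : uS) : uL := reduced_hom (uL_gen \o ext_incl) b.

Definition W_component : lmodType Fbar :=
  component iota p sub_pm rho (char_res S c).

Definition uS_act (b : uS) : W_component -> W_component :=
  reduced_act (@comp_act _ _ _ _ _ _ _ _ _) b.

Definition induced : lmodType Fbar := tensor uS_to_uL uS_act.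

Definition induced_pure (a : uL) (w : W_component) : induced := pure _ _ a w.

Definition induced_act (x : ext L) (t : induced) : induced :=
  tensor_act (uL_gen x) t.

End InducedComponent.

Variable C : {fset (L -> Fbar)}.

(* The direct sum over the finite set C, as a product. *)
Definition Vbar : Type := forall c : C, induced (fsval c).

Definition Vbar_act (x : ext L) (v : Vbar) : Vbar :=
  fun c => induced_act x (v c).

(* The family of the w_c in the decomposition w = \sum_(c in C) w_c, which    *)
(* exists and is unique when C restricts simply to S and Cl(W) = C|S.        *)
Definition W_components (w : ext W) : forall c : C, W_component (fsval c) :=
  xget (fun c => 0)
    [set f : forall c : C, W_component (fsval c) |
       w = \sum_(c : C) comp_val (f c)]%classic.

Section Invariants.
Variables (n m : nat) (e : n.-tuple L) (b : m.-tuple W).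

Definition PBW_monomial (c : L -> Fbar) (r : {ffun 'I_n -> 'I_p}) : uL c :=
  \prod_(j < n) uL_gen c (emb iota (tnth e j)) ^+ r j.

Definition PBW_tensor (r : {ffun 'I_n -> 'I_p}) (w : ext W) : Vbar :=
  fun c => induced_pure (PBW_monomial (fsval c) r) (W_components w c).

Definition PBW_comb (lam : {ffun 'I_n -> 'I_p} -> 'I_m -> Fbar) : Vbar :=
  fun c => \sum_r \sum_i lam r i *: PBW_tensor r (emb iota (tnth b i)) c.

(* The graph of the action of alpha. The e(r) (x) b^i form a basis of Vbar by *)
(* Poincare-Birkhoff-Witt, hence this relation is a function of v.           *)
Definition galois_act (alpha : {rmorphism Fbar -> Fbar}) (v v' : Vbar) : Prop :=
  exists2 lam, v = PBW_comb lam & v' = PBW_comb (fun r i => alpha (lam r i)).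

Definition galois_invariant (v : Vbar) : Prop :=
  forall alpha, galois_aut iota alpha -> galois_act alpha v v.

End Invariants.

Definition cobasis (n : nat) (e : n.-tuple L) : Prop :=
  exists U : {vspace L},
    [/\ (S + U)%VS = fullv, (S :&: U)%VS = 0%VS & basis_of U e].

End Induced.

Arguments sub_br {F L} br S s t.
Arguments sub_pm {F L} pm S s.

(* Main.v *)
(* An automorphism alpha induces alpha-semilinear maps u(L,c) -> u(L,alpha c)  *)
(* and W_c -> W_(alpha c), hence T_c : V_c -> V_(alpha c) by the universal     *)
(* property of the tensor product. T commutes with every x in L, which alpha   *)
(* fixes, and sends e(r) (x) w to e(r) (x) alpha(w), so that on combinations   *)
(* of the e(r) (x) b^i it acts by alpha on the coefficients. These tensors     *)
(* span V (the easy half of the Poincare-Birkhoff-Witt theorem), so x v is a   *)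
(* combination of them, and T(x v) = x T(v) = x v. Their linear independence   *)
(* is never used. The tensor product is balanced over the whole of u(S,c), and *)
(* not only over the rational elements of S, because phi is additive, by       *)
(* Jacobson's formula for (x + y)^p.                                           *)
From HB Require Import structures.
Require Import Defs.
From mathcomp Require Import all_boot all_algebra finmap boolp.
From mathcomp Require Import classical_sets monalg ring.

Set Implicit Arguments.
Unset Strict Implicit.
Unset Printing Implicit Defensive.

Import GRing.Theory.
Local Open Scope ring_scope.

(** * Universal properties of the algebras and of the tensor product *)

(** The action of alpha on V is defined through coordinates; the point is to recognise it as an
    intrinsic map. Since alpha fixes L, S and W pointwise, applying it to coordinates ([map_ext])
    respects brackets, p-maps and the action on Fbar (x) W, and turns a character c into alpha c. It
    therefore induces alpha-semilinear maps of reduced enveloping algebras ([twist_uL]) and of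
    components ([twist_comp]), and together these give [twist] on induced modules, which commutes
    with L ([twist_act]). As alpha fixes the e_j and the b^i, [twist] applies alpha to the
    coefficients of any combination of the e(r) (x) b^i ([comb_twist]). Invariance of v thus yields
    v_(alpha c) = T(v_c) for all c, a property that passes to x v. Writing x v as a combination
    ([comb_spanning]) turns the property back into invariance ([galois_invariant_act]).

    Three facts support this. By Jacobson's formula, phi is p-semilinear and commutes with the
    module action ([phiD_phi_comm]), so conditions checked on S hold on Fbar (x) S; components are
    then submodules, and amenability makes each a module over the reduced algebra. Next, Fbar (x) W
    is the sum of its components, by primary decomposition of the commuting phi_s
    ([component_decomp]), and the sum is direct ([component_uniq]); uniqueness of the w_c gives
    their compatibility with alpha ([wcomp_twist]). Finally, straightening of words shows that
    ordered monomials in a cobasis span ([PBW_spanning]). *)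

Lemma zmod_morphD (U V : zmodType) (f : U -> V) :
  zmod_morphism f -> {morph f : x y / x + y}.
Proof.
move=> fB x y; have f0 : f 0 = 0 by have := fB 0 0; rewrite !subrr.
have fN : f (- y) = - f y by have := fB 0 y; rewrite f0 !sub0r.
by have := fB x (- y); rewrite fN !opprK.
Qed.

Lemma zmod_morph0 (U V : zmodType) (f : U -> V) : zmod_morphism f -> f 0 = 0.
Proof. by move=> fB; have := fB 0 0; rewrite !subrr. Qed.

Lemma zmod_morph_sum (U V : zmodType) (f : U -> V) I (r : seq I) P (F : I -> U) :
  zmod_morphism f -> f (\sum_(i <- r | P i) F i) = \sum_(i <- r | P i) f (F i).
Proof.
move=> fB; apply: (big_morph f); [exact: zmod_morphD | exact: zmod_morph0].
Qed.

Lemma linear_scale (R : pzRingType) (U V : lmodType R) (f : U -> V) :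
  linear f -> scalable f.
Proof. exact: scalable_linear. Qed.

Section MalgSum.
Local Open Scope fset_scope.
Variables (K : choiceType) (G N : zmodType) (f : K -> G -> N).
Hypothesis fB : forall m, zmod_morphism (f m).

(** The common shape of [free_hom], [free_act] and [tensor_lift], whose additivity is thus proved
    once. *)
Definition malg_sum (g : {malg G[K]}) : N := \sum_(m <- msupp g) f m g@_m.

Lemma malg_sumw (d : {fset K}) (g : {malg G[K]}) :
  msupp g `<=` d -> malg_sum g = \sum_(m <- d) f m g@_m.
Proof.
move=> gd; apply: big_fset_incl => // m _ /mcoeff_outdom ->.
exact: zmod_morph0.
Qed.

Lemma malg_sumB : zmod_morphism malg_sum.
Proof.
move=> g h; pose d := msupp g `|` msupp h.
rewrite (@malg_sumw d (g - h)) ?msuppB_le // (@malg_sumw d g) ?fsubsetUl //.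
rewrite (@malg_sumw d h) ?fsubsetUr // -sumrB.
by apply: eq_bigr => m _; rewrite mcoeffB fB.
Qed.

Lemma malg_sumU a m : malg_sum << a *g m >> = f m a.
Proof. by rewrite (malg_sumw msuppU_le) big_seq_fset1 mcoeffUU. Qed.

End MalgSum.

Lemma malg_ext (K : choiceType) (G N : zmodType)
    (f g : {malg G[K]} -> N) :
  zmod_morphism f -> zmod_morphism g ->
  (forall a m, f << a *g m >> = g << a *g m >>) -> f =1 g.
Proof.
move=> fB gB fg u; rewrite [u]monalgE !zmod_morph_sum //.
by apply: eq_bigr => m _; apply: fg.
Qed.

Section FreeHom.
Variables (k : fieldType) (K : choiceType) (A : assocAlg k) (h : K -> A).

Let term (m : {fmonom K}) (a : k) : A := alg_scal A a * \prod_(x <- (m : seq K)) h x.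

Let termB m : zmod_morphism (term m).
Proof. by move=> a b; rewrite /term rmorphB mulrBl. Qed.

Lemma free_homB : zmod_morphism (free_hom h).
Proof. exact: (malg_sumB termB). Qed.

Lemma free_homU a m :
  free_hom h << a *g m >> = alg_scal A a * \prod_(x <- (m : seq K)) h x.
Proof. exact: (malg_sumU termB). Qed.

Lemma free_hom_gen x : free_hom h (free_gen k x) = h x.
Proof. by rewrite free_homU rmorph1 mul1r fmuE big_seq1. Qed.

Lemma free_hom_scal a : free_hom h (alg_scal (freealg k K) a) = alg_scal A a.
Proof. by rewrite free_homU fm1 big_nil mulr1. Qed.

Lemma free_homM : {morph free_hom h : u v / u * v}.
Proof.
have distl w : zmod_morphism (fun u => free_hom h (u * w)).
  by move=> u v; rewrite mulrBl free_homB.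
have distr w : zmod_morphism (fun u => free_hom h (w * u)).
  by move=> u v; rewrite mulrBr free_homB.
move=> u v; move: u; apply: (malg_ext (distl v)) => [u1 u2|a m].
  by rewrite free_homB mulrBl.
move: v; apply: (malg_ext (distr _)) => [u1 u2|b m'].
  by rewrite free_homB mulrBr.
rewrite malgM_def fgmulUU !free_homU rmorphM -!mulrA; congr (_ * _).
have -> : (mmul m m' : seq K) = m ++ m' by rewrite /mmul /= fmmulE.
by rewrite big_cat /= mulrA alg_scalC -mulrA.
Qed.

Lemma free_homD : {morph free_hom h : u v / u + v}.
Proof. exact: zmod_morphD free_homB. Qed.

Lemma free_hom_ideal u g g' : free_hom h u = 0 -> free_hom h (g * (u * g')) = 0.
Proof. by move=> u0; rewrite (free_homM g _) (free_homM u g') u0 mul0r mulr0. Qed.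

Lemma free_homX x m : free_hom h (free_gen k x ^+ m) = h x ^+ m.
Proof.
elim: m => [|m ih].
  by rewrite !expr0 -(rmorph1 (alg_scal (freealg k K))) free_hom_scal rmorph1.
by rewrite !exprS (free_homM (free_gen k x) _) ih free_hom_gen.
Qed.

End FreeHom.

Section FreeAct.
Variables (k : fieldType) (K : choiceType) (N : lmodType k) (h : K -> N -> N).
Hypothesis h_lin : forall x, linear (h x).

Let termB v (m : {fmonom K}) : zmod_morphism (fun a => a *: foldr h v (m : seq K)).
Proof. by move=> a b; rewrite scalerBl. Qed.

Lemma free_actB v : zmod_morphism (fun g => free_act h g v).
Proof. exact: (malg_sumB (termB v)). Qed.

Lemma free_actU a m v : free_act h << a *g m >> v = a *: foldr h v (m : seq K).
Proof. exact: (malg_sumU (termB v)). Qed.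

Lemma free_act_gen x v : free_act h (free_gen k x) v = h x v.
Proof. by rewrite free_actU scale1r fmuE. Qed.

Lemma free_act_scal a v : free_act h (alg_scal (freealg k K) a) v = a *: v.
Proof. by rewrite free_actU fm1. Qed.

Lemma foldr_linear (s : seq K) : linear (foldr h ^~ s).
Proof. by elim: s => [//|x s ih] a u v /=; rewrite ih h_lin. Qed.

Lemma free_act_linear g : linear (free_act h g).
Proof.
move=> a u v; rewrite /free_act scaler_sumr -big_split /=.
apply: eq_bigr => m _; rewrite foldr_linear scalerDr !scalerA.
by rewrite mulrC.
Qed.

Lemma free_actM g g' v : free_act h (g * g') v = free_act h g (free_act h g' v).
Proof.
have distl w : zmod_morphism (fun u => free_act h (u * w) v).
  by move=> u1 u2; rewrite mulrBl free_actB.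
have distr w : zmod_morphism (fun u => free_act h (w * u) v).
  by move=> u1 u2; rewrite mulrBr free_actB.
move: g; apply: (malg_ext (distl g')) => [u1 u2|a m].
  by rewrite free_actB.
move: g'; apply: (malg_ext (distr _)) => [u1 u2|b m'].
  by rewrite free_actB (zmod_morphism_linear (free_act_linear _)).
rewrite malgM_def fgmulUU !free_actU.
have -> : (mmul m m' : seq K) = m ++ m' by rewrite /mmul /= fmmulE.
by rewrite foldr_cat (linear_scale (foldr_linear _)) scalerA.
Qed.

Lemma free_act_ideal u g g' v : (forall w, free_act h u w = 0) ->
  free_act h (g * (u * g')) v = 0.
Proof.
move=> u0; rewrite (free_actM g _) (free_actM u g') u0.
exact: zmod_morph0 (zmod_morphism_linear (free_act_linear g)).
Qed.

Lemma free_actX x m v : free_act h (free_gen k x ^+ m) v = iter m (h x) v.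
Proof.
elim: m v => [|m ih] v; last first.
  by rewrite exprS (free_actM (free_gen k x) _) ih free_act_gen.
by rewrite expr0 -(rmorph1 (alg_scal (freealg k K))) free_act_scal scale1r.
Qed.

End FreeAct.

(** Two representatives of a class differ by an element of the ideal, which f kills; so maps defined
    through [qring_repr] can be computed on any representative. *)
Lemma qring_factor (R : pzRingType) (X : R -> Prop) (Z : zmodType) (f : R -> Z) :
  zmod_morphism f -> (forall a x b, X x -> f (a * (x * b)) = 0) ->
  forall u, f (qring_repr (qring_pi X u)) = f u.
Proof.
move=> fB fX u; apply/eqP; rewrite -subr_eq0 -fB; apply/eqP.
elim: (@qmod_pi_repr R R^o (ideal_gen X) u) => [|a _ v [x b Xx] _ ih].
  exact: zmod_morph0.
by rewrite (zmod_morphD fB) [X in _ + X]ih addr0 fX.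
Qed.

Lemma qring_piM3 (R : pzRingType) (X : R -> Prop) (u x v : R) :
  qring_pi X u * (qring_pi X x * qring_pi X v) = qring_pi X (u * (x * v)).
Proof. by rewrite !rmorphM. Qed.

(** * Reduced enveloping algebras: extension of homomorphisms and actions *)

Section Reduced.
Variables (p : nat) (k : fieldType) (K : lmodType k).
Variables (br : K -> K -> K) (pm : K -> K) (c : K -> k).
Local Notation red := (reduced p br pm c).
Local Notation gen := (reduced_gen p br pm c).
Local Notation pi2 g := (qring_pi (reduced_rel p pm c) (qring_pi (uea_rel br) g)).

(** The reduced algebra is a quotient of a quotient of the free algebra, so [qring_factor] is
    applied twice. Asking only additivity of f covers both homomorphisms and the maps g |-> g v for
    a fixed vector v. *)
Lemma reduced_factor (Z : zmodType) (f : {malg k[{fmonom K}]} -> Z) :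
  zmod_morphism f ->
  (forall g a x y g', f (g * ((free_gen k (a *: x + y)
     - (alg_scal (freealg k K) a * free_gen k x + free_gen k y)) * g')) = 0) ->
  (forall g x y g', f (g * ((free_gen k x * free_gen k y - free_gen k y * free_gen k x
     - free_gen k (br x y)) * g')) = 0) ->
  (forall g x g', f (g * ((free_gen k x ^+ p - free_gen k (pm x)
     - alg_scal (freealg k K) (c x ^+ p)) * g')) = 0) ->
  forall g, f (qring_repr (qring_repr (pi2 g : red))) = f g.
Proof.
move=> fB f1 f2 f3.
have fE u : f (qring_repr (qring_pi (uea_rel br) u)) = f u.
  by apply: qring_factor => // a _ b [].
(* The map that f induces on the universal enveloping algebra, to be factored once more. *)
pose f' (u : uea br) := f (qring_repr u).
move=> g; rewrite -[RHS]fE -!/(f' _); apply: qring_factor.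
  move=> u v; rewrite -[u]qring_reprK -[v]qring_reprK -rmorphB /f' !fE.
  exact: fB.
move=> u _ v [x].
have -> : uea_gen br x ^+ p - uea_gen br (pm x) - alg_scal (uea br) (c x ^+ p) =
    qring_pi (uea_rel br) (free_gen k x ^+ p - free_gen k (pm x)
      - alg_scal (freealg k K) (c x ^+ p)).
  rewrite rmorphB; apply: (congr2 (fun s t => s - t) _ (erefl _)).
  by rewrite rmorphB rmorphXn.
have e := qring_piM3 (uea_rel br) (qring_repr u) (free_gen k x ^+ p - free_gen k (pm x)
      - alg_scal (freealg k K) (c x ^+ p)) (qring_repr v).
move: e; rewrite qring_reprK qring_reprK => e.
exact: etrans (congr1 f' e) (etrans (fE _) (f3 _ _ _)).
Qed.

(** Words in the generators span, and a word is built from 1 by left multiplications. *)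
Lemma reduced_ind (P : red -> Prop) :
  P 1 -> (forall u v, P u -> P v -> P (u + v)) ->
  (forall a u, P u -> P (alg_scal red a * u)) ->
  (forall x u, P u -> P (gen x * u)) -> forall u, P u.
Proof.
move=> P1 PD Ps Pg u; rewrite -[u]qring_reprK -[qring_repr u]qring_reprK.
rewrite [qring_repr (qring_repr u)]monalgE !rmorph_sum /=.
have P0 : P 0 by rewrite -(mul0r 1) -(rmorph0 (alg_scal red)); apply: Ps.
elim/big_ind: _ => // m _; move: (_@_m) => a.
have -> : << a *g m >> = alg_scal (freealg k K) a * \prod_(x <- (m : seq K)) free_gen k x.
  have -> : \prod_(x <- (m : seq K)) free_gen k x = << m >>.
    case: m => m /=; elim: m => [|x m ih]; first by rewrite big_nil -fmoneE.
    by rewrite big_cons ih malgM_def fgmulUU mulr1 /mmul /= fmmulE fmuE.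
  by rewrite /= malgM_def fgmulUU mulr1 mul1m.
rewrite !rmorphM /=; apply: Ps.
rewrite !rmorph_prod /=; elim: (m : seq K) => [|x s ih]; rewrite ?big_nil //.
by rewrite big_cons; apply: Pg.
Qed.

Lemma red_genD a x y : gen (a *: x + y) = alg_scal red a * gen x + gen y.
Proof.
rewrite /reduced_gen /uea_gen /= -!rmorphM -!rmorphD; congr (qring_pi _ _).
apply/eqP; rewrite -subr_eq0 -rmorphB; apply/eqP.
rewrite -[RHS](rmorph0 (qring_pi (uea_rel br))).
apply/qmod_piP; rewrite subr0 -[X in spanned _ X]mulr1 -[X in spanned _ X]mul1r.
rewrite -[X in spanned _ X]addr0; apply: (@SpannedS _ _ _ 1); last exact: Spanned0.
exact/IdealGen/UeaLinear.
Qed.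

Lemma red_genM x y : gen x * gen y = gen y * gen x + gen (br x y).
Proof.
rewrite /reduced_gen /uea_gen /= -!rmorphM -!rmorphD; congr (qring_pi _ _).
apply/eqP; rewrite -subr_eq0 -rmorphB; apply/eqP.
rewrite -[RHS](rmorph0 (qring_pi (uea_rel br))).
apply/qmod_piP; rewrite subr0 opprD addrA.
rewrite -[X in spanned _ X]mulr1 -[X in spanned _ X]mul1r.
rewrite -[X in spanned _ X]addr0; apply: (@SpannedS _ _ _ 1); last exact: Spanned0.
exact/IdealGen/UeaBracket.
Qed.

Lemma red_genX x : gen x ^+ p = gen (pm x) + alg_scal red (c x ^+ p).
Proof.
apply/eqP; rewrite -subr_eq0 opprD addrA; apply/eqP.
rewrite /reduced_gen /= -rmorphXn -!rmorphB.
rewrite -[RHS](rmorph0 (qring_pi (reduced_rel p pm c))).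
apply/qmod_piP; rewrite subr0.
rewrite -[X in spanned _ X]mulr1 -[X in spanned _ X]mul1r.
rewrite -[X in spanned _ X]addr0; apply: (@SpannedS _ _ _ 1); last exact: Spanned0.
exact/IdealGen/ReducedRel.
Qed.

Section Hom.
Variables (A : assocAlg k) (h : K -> A).
Hypothesis hD : forall a x y, h (a *: x + y) = alg_scal A a * h x + h y.
Hypothesis hbr : forall x y, h (br x y) = h x * h y - h y * h x.
Hypothesis hpm : forall x, h x ^+ p = h (pm x) + alg_scal A (c x ^+ p).

Lemma reduced_homE g : reduced_hom h (pi2 g : red) = free_hom h g.
Proof.
apply: reduced_factor; first exact: free_homB.
- move=> g1 a x y g2; apply: free_hom_ideal.
  have eM : free_hom h (alg_scal (freealg k K) a * free_gen k x) = alg_scal A a * h x.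
    by rewrite free_homM free_hom_scal free_hom_gen.
  apply: etrans (free_homB h _ _) _.
  apply: etrans (congr2 (fun a b => a - b) (free_hom_gen h _) (free_homD h _ _)) _.
  by rewrite eM free_hom_gen hD subrr.
- move=> g1 x y g2; apply: free_hom_ideal.
  have eM s t : free_hom h (free_gen k s * free_gen k t) = h s * h t.
    by rewrite free_homM !free_hom_gen.
  have e := etrans (free_homB h _ _) (congr2 (fun a b => a - b) (eM x y) (eM y x)).
  apply: etrans (free_homB h (_ - _) _) _.
  apply: etrans (congr2 (fun a b => a - b) e (free_hom_gen h _)) _.
  by rewrite hbr subrr.
move=> g1 x g2; apply: free_hom_ideal.
have e := free_homB h (free_gen k x ^+ p) (free_gen k (pm x)).
rewrite free_homX free_hom_gen in e.
by rewrite free_homB e free_hom_scal hpm addrAC addrK subrr.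
Qed.

Lemma reduced_homB : zmod_morphism (reduced_hom h : red -> A).
Proof.
move=> u v; rewrite -[u]qring_reprK -[v]qring_reprK.
rewrite -[qring_repr u]qring_reprK -[qring_repr v]qring_reprK.
by rewrite -!rmorphB !reduced_homE free_homB.
Qed.

Lemma reduced_homM (u v : red) :
  reduced_hom h (u * v) = reduced_hom h u * reduced_hom h v.
Proof.
rewrite -[u]qring_reprK -[v]qring_reprK.
rewrite -[qring_repr u]qring_reprK -[qring_repr v]qring_reprK.
by rewrite -!rmorphM !reduced_homE free_homM.
Qed.

Lemma reduced_hom_gen x : reduced_hom h (gen x) = h x.
Proof. by rewrite reduced_homE free_hom_gen. Qed.

Lemma reduced_hom_scal a : reduced_hom h (alg_scal red a) = alg_scal A a.
Proof. by rewrite reduced_homE free_hom_scal. Qed.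

Lemma reduced_hom1 : reduced_hom h (1 : red) = 1.
Proof. by rewrite -(rmorph1 (alg_scal red)) reduced_hom_scal rmorph1. Qed.

End Hom.

Section Act.
Variables (N : lmodType k) (h : K -> N -> N).
Hypothesis h_lin : forall x, linear (h x).
Hypothesis hD : forall a x y v, h (a *: x + y) v = a *: h x v + h y v.
Hypothesis hbr : forall x y v, h (br x y) v = h x (h y v) - h y (h x v).
Hypothesis hpm : forall x v, iter p (h x) v = h (pm x) v + c x ^+ p *: v.

Lemma reduced_actE g v : reduced_act h (pi2 g : red) v = free_act h g v.
Proof.
apply: (reduced_factor (f := fun g => free_act h g v)).
- exact: free_actB.
- move=> g1 a x y g2; apply: free_act_ideal => // w.
  have eM : free_act h (alg_scal (freealg k K) a * free_gen k x) w = a *: h x w.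
    by rewrite free_actM // free_act_scal free_act_gen.
  apply: etrans (free_actB h w _ _) _.
  apply: etrans (congr2 (fun a b => a - b) (free_act_gen h _ w)
    (zmod_morphD (free_actB h w) _ _)) _.
  by rewrite eM free_act_gen hD subrr.
- move=> g1 x y g2; apply: free_act_ideal => // w.
  have eM s t : free_act h (free_gen k s * free_gen k t) w = h s (h t w).
    by rewrite free_actM // !free_act_gen.
  have e := etrans (free_actB h w _ _) (congr2 (fun a b => a - b) (eM x y) (eM y x)).
  apply: etrans (free_actB h w (_ - _) _) _.
  apply: etrans (congr2 (fun a b => a - b) e (free_act_gen h _ w)) _.
  by rewrite hbr subrr.
move=> g1 x g2; apply: free_act_ideal => // w.
have e := free_actB h w (free_gen k x ^+ p) (free_gen k (pm x)).
rewrite free_actX // free_act_gen in e.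
by rewrite free_actB e free_act_scal hpm addrAC addrK subrr.
Qed.

Lemma reduced_actB v : zmod_morphism (fun u : red => reduced_act h u v).
Proof.
move=> u w; rewrite -[u]qring_reprK -[w]qring_reprK.
rewrite -[qring_repr u]qring_reprK -[qring_repr w]qring_reprK.
by rewrite -!rmorphB !reduced_actE free_actB.
Qed.

Lemma reduced_actM (u w : red) v :
  reduced_act h (u * w) v = reduced_act h u (reduced_act h w v).
Proof.
rewrite -[u]qring_reprK -[w]qring_reprK.
rewrite -[qring_repr u]qring_reprK -[qring_repr w]qring_reprK.
by rewrite -!rmorphM !reduced_actE free_actM.
Qed.

Lemma reduced_act_gen x v : reduced_act h (gen x) v = h x v.
Proof. by rewrite reduced_actE free_act_gen. Qed.

Lemma reduced_act_scal a v : reduced_act h (alg_scal red a) v = a *: v.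
Proof. by rewrite reduced_actE free_act_scal. Qed.

End Act.
End Reduced.

(** * Universal property of the tensor product, in semilinear form *)

Section Tensor.
Variables (k : fieldType) (A : assocAlg k) (B : Type) (M : lmodType k).
Variables (f : B -> A) (act : B -> M -> M).
Local Notation pur := (pure f act).
Local Notation tens := (tensor f act).

Lemma spanned_gen (V : lmodType k) (X : V -> Prop) x : X x -> spanned X x.
Proof.
by move=> Xx; rewrite -[x]scale1r -[1 *: x]addr0; apply: SpannedS Xx (Spanned0 _).
Qed.

Lemma pureDl a a' m : pur (a + a') m = pur a m + pur a' m.
Proof.
rewrite /pure -raddfD; apply/qmod_piP; rewrite opprD addrA.
exact/spanned_gen/TensorDl.
Qed.

Lemma pureDr a m m' : pur a (m + m') = pur a m + pur a m'.
Proof.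
rewrite /pure -raddfD; apply/qmod_piP; rewrite opprD addrA.
exact/spanned_gen/TensorDr.
Qed.

Lemma pureZl l a m : pur (alg_scal A l * a) m = l *: pur a m.
Proof.
rewrite /pure -linearZ; apply/qmod_piP.
exact/spanned_gen/TensorZ.
Qed.

Lemma pure_bal a b m : pur (a * f b) m = pur a (act b m).
Proof. exact/qmod_piP/spanned_gen/TensorB. Qed.

Lemma tensor_ind (P : tens -> Prop) :
  P 0 -> (forall t u, P t -> P u -> P (t + u)) ->
  (forall l a m, P (l *: pur a m)) -> forall t, P t.
Proof.
move=> P0 PD Pp t; rewrite -[t]qmod_reprK [qmod_repr t]monalgE raddf_sum.
elim/big_ind: _ => // -[a m] _; move: (_@_(a, m)) => l.
suff -> : << l *g (a, m) >> = l *: << (a, m) >>.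
  by move: (Pp l a m); rewrite /pure -linearZ.
by apply/malgP => y; rewrite mcoeffZ !mcoeffU mulr_natr.
Qed.

Lemma tensor_ext (N : zmodType) (f1 f2 : tens -> N) :
  zmod_morphism f1 -> zmod_morphism f2 ->
  (forall l a m, f1 (l *: pur a m) = f2 (l *: pur a m)) -> f1 =1 f2.
Proof.
move=> f1B f2B f12; apply: tensor_ind => // [|t u e1 e2].
  by rewrite (zmod_morph0 f1B) (zmod_morph0 f2B).
by rewrite (zmod_morphD f1B) (zmod_morphD f2B) e1 e2.
Qed.

(* [alpha] is arbitrary so that the lift can be semilinear. *)
Section Lift.
Variables (N : lmodType k) (alpha : k -> k) (g : A -> M -> N).
Hypothesis alphaB : zmod_morphism alpha.
Hypothesis alphaM : {morph alpha : a b / a * b}.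
Hypothesis alpha1 : alpha 1 = 1.
Hypothesis gDl : forall a a' m, g (a + a') m = g a m + g a' m.
Hypothesis gDr : forall a m m', g a (m + m') = g a m + g a m'.
Hypothesis gZ : forall l a m, g (alg_scal A l * a) m = alpha l *: g a m.
Hypothesis g_bal : forall a b m, g (a * f b) m = g a (act b m).

Definition tensor_lift (t : tens) : N :=
  \sum_(x <- msupp (qmod_repr t)) alpha (qmod_repr t)@_x *: g x.1 x.2.

Let term (x : A * M) (l : k) : N := alpha l *: g x.1 x.2.
Let termB x : zmod_morphism (term x).
Proof. by move=> a b; rewrite /term alphaB scalerBl. Qed.

Let F (u : {malg k[(A * M)%type]}) : N := \sum_(x <- msupp u) alpha u@_x *: g x.1 x.2.
Let FB : zmod_morphism F. Proof. exact: (malg_sumB termB). Qed.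
Let FU l x : F << l *g x >> = alpha l *: g x.1 x.2.
Proof. exact: (malg_sumU termB). Qed.

Let FZ l u : F (l *: u) = alpha l *: F u.
Proof.
move: u; apply: malg_ext.
- by move=> u v; rewrite scalerBr FB.
- by move=> u v; rewrite FB scalerBr.
move=> a x; have -> : l *: << a *g x >> = << l * a *g x >>.
  by apply/malgP => y; rewrite mcoeffZ !mcoeffU mulrnAr.
by rewrite !FU alphaM scalerA.
Qed.

Let F_pi u : tensor_lift (qmod_pi (tensor_rel f act) u) = F u.
Proof.
apply/eqP; rewrite -subr_eq0; apply/eqP.
rewrite [LHS](_ : _ = F (qmod_repr (qmod_pi (tensor_rel f act) u) - u)); last first.
  by rewrite FB.
elim: (qmod_pi_repr (tensor_rel f act) u) => [|l x v Xx _ ih].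
  exact: zmod_morph0.
rewrite (zmod_morphD FB) ih addr0 FZ.
suff -> : F x = 0 by rewrite scaler0.
case: Xx => [a a' m|a m m'|l' a m|a b m]; rewrite !FB ?FZ !FU /= alpha1 !scale1r.
- by rewrite gDl addrAC addrK subrr.
- by rewrite gDr addrAC addrK subrr.
- by rewrite gZ subrr.
by rewrite g_bal subrr.
Qed.

Lemma tensor_lift_pure a m : tensor_lift (pur a m) = g a m.
Proof. by rewrite F_pi FU alpha1 scale1r. Qed.

Lemma tensor_liftB : zmod_morphism tensor_lift.
Proof.
by move=> t u; rewrite -[t]qmod_reprK -[u]qmod_reprK -raddfB !F_pi FB.
Qed.

Lemma tensor_liftZ l t : tensor_lift (l *: t) = alpha l *: tensor_lift t.
Proof. by rewrite -[t]qmod_reprK -linearZ !F_pi FZ. Qed.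

End Lift.

(** [tensor_act] is the case alpha = id of [tensor_lift], for the map (a, m) |-> a0 a (x) m; this
    map is balanced because left multiplication by a0 commutes with right multiplication by the f
    b. *)
Lemma tensor_act_spec a0 :
  [/\ forall a m, tensor_act (f := f) (act := act) a0 (pur a m) = pur (a0 * a) m,
      zmod_morphism (tensor_act (f := f) (act := act) a0) &
      forall l t, tensor_act (f := f) (act := act) a0 (l *: t) = l *: tensor_act a0 t].
Proof.
have gDl a a' m : pur (a0 * (a + a')) m = pur (a0 * a) m + pur (a0 * a') m.
  by rewrite mulrDr pureDl.
have gDr a m m' : pur (a0 * a) (m + m') = pur (a0 * a) m + pur (a0 * a) m'.
  exact: pureDr.
have gZ l a m : pur (a0 * (alg_scal A l * a)) m = l *: pur (a0 * a) m.
  by rewrite mulrA -alg_scalC -mulrA pureZl.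
have g_bal a b m : pur (a0 * (a * f b)) m = pur (a0 * a) (act b m).
  by rewrite mulrA pure_bal.
have idB : zmod_morphism (@id k) by [].
have idM : {morph @id k : a b / a * b} by [].
split.
- exact: (tensor_lift_pure idB idM erefl gDl gDr gZ g_bal).
- exact: (tensor_liftB idB idM erefl gDl gDr gZ g_bal).
exact: (tensor_liftZ idB idM erefl gDl gDr gZ g_bal).
Qed.

End Tensor.

(** * Jacobson's formula *)

Section Commutators.
Variable R : pzRingType.
Definition ad (x y : R) : R := x * y - y * x.

(** [ad x] is the difference of left and right multiplication by x, which commute: this is the
    binomial theorem, proved with Pascal's rule. *)
Lemma iter_ad m (x y : R) :
  iter m (ad x) y = \sum_(i < m.+1) (-1) ^+ i * 'C(m, i)%:R * (x ^+ (m - i) * y * x ^+ i).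
Proof.
pose T m i := (-1) ^+ i * 'C(m, i)%:R * (x ^+ (m - i) * y * x ^+ i).
rewrite -[RHS]/(\sum_(i < m.+1) T m i).
have cm (z w : R) i j : z * ((-1) ^+ i * j%:R * w) = (-1) ^+ i * j%:R * (z * w).
  rewrite [LHS]mulrA [RHS]mulrA; congr (_ * _); apply: commrM; last exact: commr_nat.
  exact/commrX/commrN1.
elim: m => [|m ih]; first by rewrite big_ord1 /T /= bin0 !mulr1 mul1r mul1r.
rewrite iterS ih /ad mulr_sumr mulr_suml.
rewrite [RHS]big_ord_recl [X in X - _]big_ord_recl [X in _ - X]big_ord_recr /=.
have -> : x * T m (@ord0 m) = T m.+1 (@ord0 m.+1).
  by rewrite /T /= !bin0 !mulr1 !mul1r !subn0 exprS mulrA.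
rewrite -addrA; congr (_ + _); rewrite opprD addrA -sumrB.
rewrite [RHS]big_ord_recr /=; congr (_ + _).
  apply: eq_bigr => i _; rewrite /T /bump /= add1n binS natrD mulrDr mulrDl subSS.
  congr (_ + _).
    by rewrite cm; congr (_ * _); rewrite !mulrA -exprS -subSn // subSS.
  by rewrite [(-1) ^+ i.+1]exprS mulN1r !mulNr exprSr !mulrA.
rewrite /T /bump /= add1n !binn subnn subnn expr0 !mul1r !mulr1 exprSr mulrN1 mulNr.
by rewrite -!mulrA -exprSr.
Qed.
End Commutators.

Section CharP.
Variables (R : nzRingType) (p : nat) (pR : p \in [pchar R]).

(** Two consecutive binomials C(p-1, i) and C(p-1, i+1) add up to C(p, i+1), which is 0 in
    characteristic p for i+1 < p. *)
Lemma signr_bin_pred i : (i < p)%N -> (-1) ^+ i * 'C(p.-1, i)%:R = 1 :> R.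
Proof.
have p0 : (0 < p)%N by rewrite prime_gt0 // (pcharf_prime pR).
elim: i => [|i ih] ip; first by rewrite bin0 mulr1.
have := binS p.-1 i; rewrite (prednK p0) => e.
have : 'C(p, i.+1)%:R = 0 :> R.
  apply/eqP; rewrite -(dvdn_pcharf pR) prime_dvd_bin ?(pcharf_prime pR) //.
rewrite e natrD => /eqP; rewrite addr_eq0 => /eqP ->.
by rewrite exprS mulN1r mulrNN ih // ltnW.
Qed.

(** The inner binomials C(p, i) vanish, leaving the two extreme terms. The sign (-1)^p is -1 for p =
    2 as well, by Frobenius. *)
Lemma iter_ad_char (x y : R) : iter p (ad x) y = ad (x ^+ p) y.
Proof.
have pp := pcharf_prime pR; have p0 := prime_gt0 pp.
rewrite iter_ad big_ord_recr /= subnn binn expr0 mul1r mulr1.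
have -> : (-1) ^+ p = -1 :> R 
  by rewrite -[LHS](pFrobenius_autE pR) pFrobenius_autN pFrobenius_aut1.
rewrite mulN1r /ad; congr (_ - _); rewrite (bigD1 (Ordinal p0)) //=.
rewrite bin0 subn0 !mulr1 mul1r big1 ?addr0 // => i i0.
have -> : 'C(p, i)%:R = 0 :> R.
  by apply/eqP; rewrite -(dvdn_pcharf pR) prime_dvd_bin // ltn_ord andbT lt0n.
by rewrite mulr0 mul0r.
Qed.

Lemma iter_ad_pred (x y : R) :
  iter p.-1 (ad x) y = \sum_(i < p) x ^+ (p.-1 - i) * y * x ^+ i.
Proof.
have p0 : (0 < p)%N by rewrite prime_gt0 // (pcharf_prime pR).
by rewrite iter_ad prednK //; apply: eq_bigr => i _; rewrite signr_bin_pred ?mul1r.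
Qed.

End CharP.

Section Jacobson.
Variables (k : fieldType) (p : nat) (pk : p \in [pchar k]).
Variables (K : lmodType k) (br : K -> K -> K) (R : algType k) (h : K -> R).
Hypothesis hl : linear h.
Hypothesis hbr : forall x y, h (br x y) = h x * h y - h y * h x.

Lemma derivX_noncomm (q : {poly R}) m :
  (q ^+ m)^`() = \sum_(i < m) q ^+ (m.-1 - i) * q^`() * q ^+ i.
Proof.
elim: m => [|m ih]; first by rewrite big_ord0 expr0 derivC.
rewrite exprSr derivM ih big_ord_recl /= subn0 expr0 mulr1 addrC; congr (_ + _).
rewrite mulr_suml; apply: eq_bigr => i _; rewrite /bump /= add1n -mulrA -exprSr.
by case: m i {ih} => [[]//|m] i; rewrite subSS.
Qed.

Lemma pchar_alg : p \in [pchar R].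
Proof.
rewrite inE (pcharf_prime pk) /=.
by rewrite -scaler_nat pcharf0 // scale0r.
Qed.

Let h0 : h 0 = 0. Proof. exact: (zmod_morph0 (zmod_morphism_linear hl)). Qed.
Let hD x y : h (x + y) = h x + h y.
Proof. exact: (zmod_morphD (zmod_morphism_linear hl)). Qed.

(* In R[t] let Z = h(x) t + h(y). Since the commutator with Z satisfies        *)
(* ad(Z)^(p - 1)(a) = \sum_i Z^(p - 1 - i) a Z^i, the derivative of Z^p is     *)
(* ad(Z)^(p - 1)(h(x)); compare coefficients and evaluate at t = 1.            *)
Lemma jacobson_formula x y :
  h (x + y) ^+ p = h x ^+ p + h y ^+ p + \sum_(1 <= i < p) h (jacobson_s p br x y i).
Proof.
have pR := pchar_alg; have pp := pcharf_prime pk; have p0 := prime_gt0 pp.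
pose Z : {poly R} := (h x)%:P * 'X + (h y)%:P.
have dZ : Z^`() = (h x)%:P.
  by rewrite derivD derivM !derivC mul0r add0r derivX mulr1 addr0.
have coefad m j : (iter m (ad Z) (h x)%:P)`_j = h (ad_coef br x y m j).
  elim: m j => [|m ih] j /=; first by rewrite coefC; case: j.
  rewrite {1}/ad /Z mulrDl mulrDr -!mulrA -commr_polyX !mulrA.
  rewrite opprD addrACA addrC hD coefD; congr (_ + _).
    by rewrite coefB coefCM coefMC ih hbr.
  by case: j => [|j]; rewrite coefB !coefMX /= ?subrr // !coefCM !coefMC ih hbr.
have pP : p \in [pchar {poly R}] by rewrite pchar_poly.
have dZp : (Z ^+ p)^`() = iter p.-1 (ad Z) (h x)%:P.
  by rewrite derivX_noncomm (iter_ad_pred pP) dZ.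
have sZ : (size (Z ^+ p)%R <= p.+1)%N.
  apply: leq_trans (size_poly_exp_leq _ _) _; rewrite ltnS.
  rewrite -[leqRHS]mul1n leq_mul2r; apply/orP; right.
  suff : (size Z <= 2)%N by case: (size Z).
  by rewrite /Z size_MXaddC; case: ifP => // _; rewrite ltnS size_polyC leq_b1.
have Z1 : (Z ^+ p).[1] = h (x + y) ^+ p.
  rewrite horner_exp_comm; last by rewrite /comm_poly /GRing.comm mulr1 mul1r.
  by rewrite /Z !hornerE hD.
rewrite -Z1 (horner_coef_wide _ sZ).
under eq_bigr do rewrite expr1n mulr1.
rewrite big_ord_recr /= addrC.
have lead : (Z ^+ p)`_p = h x ^+ p.
  have : forall m, (Z ^+ m)`_m = h x ^+ m /\ (forall j, (m < j)%N -> (Z ^+ m)`_j = 0).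
    elim=> [|m [ih1 ih2]].
      by rewrite !expr0 coef1; split=> // -[|j] _ //; rewrite coef1.
    rewrite exprS /Z; split => [|j mj].
      rewrite mulrDl coefD -mulrA -commr_polyX mulrA coefMX coefCM ih1 exprS.
      by rewrite coefCM ih2 // mulr0 addr0.
    rewrite mulrDl coefD -mulrA -commr_polyX mulrA coefMX !coefCM.
    by case: j mj => // j mj; rewrite !ih2 ?mulr0 ?addr0 // ltnW.
  by move=> /(_ p)[].
rewrite lead -addrA; congr (_ + _).
rewrite -(big_mkord xpredT (fun i => (Z ^+ p)`_i)) (big_ltn p0); congr (_ + _).
  rewrite -horner_coef0 horner_exp_comm.
    by rewrite /Z !hornerE.
  by rewrite /comm_poly /GRing.comm mulr0 mul0r.
rewrite !big_nat; apply: eq_bigr => i /andP[i0 ip].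
rewrite /jacobson_s (linear_scale hl) -coefad -dZp coef_deriv prednK //.
rewrite -scaler_nat scalerA mulVf ?scale1r //.
by rewrite -(dvdn_pcharf pk) gtnNdvd.
Qed.
End Jacobson.

(** * The p-semilinear map phi *)

Section Phi.
Variables (k : fieldType) (p : nat) (pk : p \in [pchar k]).
Variables (K : lmodType k) (br : K -> K -> K) (pm : K -> K).
Hypothesis hK : restricted_lie p br pm.
Variables (d : nat) (rho : K -> 'rV[k]_d -> 'rV[k]_d).
Hypothesis hM : lie_module br rho.
Local Notation Phi := (phi p pm rho).

Lemma iter_linear_fun (V : lmodType k) (f : V -> V) m : linear f -> linear (iter m f).
Proof. by move=> fl; elim: m => [//|m ih] a u v; rewrite !iterS ih fl. Qed.

Lemma phi_linear x : linear (Phi x).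
Proof.
move=> a u v; rewrite /phi (iter_linear_fun _ (lmod_linearr hM x)) (lmod_linearr hM).
by rewrite scalerBr opprD addrACA.
Qed.

Lemma iterZ (a : k) (f : 'rV[k]_d -> 'rV[k]_d) m w : linear f ->
  iter m (fun v => a *: f v) w = a ^+ m *: iter m f w.
Proof.
move=> fl; elim: m => [|m ih]; first by rewrite scale1r.
by rewrite !iterS ih (linear_scale fl) scalerA exprS.
Qed.

Lemma phiZ a x w : Phi (a *: x) w = a ^+ p *: Phi x w.
Proof.
rewrite /phi (pmapZ hK) (linear_scale (lmod_linearl hM w)) scalerBr; congr (_ - _).
rewrite -iterZ; last exact: (lmod_linearr hM x).
by apply: eq_iter => v; rewrite (linear_scale (lmod_linearl hM v)).
Qed.

(** In the matrix ring, Jacobson's formula for (h x + h y)^p and the axiom for (x + y)^[p] have the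
    same correction terms, which cancel in phi. Further, h(x)^p and h(x^[p]) have equal commutators
    with each h(y), since both are the p-fold iterate of ad h(x); so their difference commutes with
    h(y). *)
Lemma phiD_phi_comm :
  (forall x y w, Phi (x + y) w = Phi x w + Phi y w) /\
  (forall x y w, Phi x (rho y w) = rho y (Phi x w)).
Proof.
have rl := lmod_linearl hM; have rr := lmod_linearr hM; have rb := lmod_br hM.
move: (rho) rl rr rb; rewrite /phi; case: d => [|n] r rl rr rb.
  (* Square matrices form a nonzero ring only in positive size, so dimension 0 is settled apart. *)
  by split=> *; rewrite [LHS]thinmx0 [RHS]thinmx0.
(* Matrices act on row vectors from the right; the transpose makes h a homomorphism instead of an
   antihomomorphism. *)
pose h x : 'M[k]_n.+1 := (lin1_mx (r x))^T.
have hE m x w : iter m (r x) w = (h x ^+ m *m w^T)^T.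
  elim: m w => [|m ih] w; first by rewrite expr0 mul1mx trmxK.
  rewrite iterS ih exprS -mulmxE -mulmxA [RHS]trmx_mul [(h x)^T]trmxK.
  have [f fE] : exists f : {linear 'rV[k]_n.+1 -> 'rV[k]_n.+1}, f =1 r x.
    pose f0 := GRing.isLinear.Build _ _ _ _ (r x) (rr x).
    pose f1 : {linear _ -> _} := HB.pack (r x) f0.
    by exists f1.
  have -> : lin1_mx (r x) = lin1_mx f by apply/matrixP => i j; rewrite !mxE fE.
  by rewrite mul_rV_lin1 fE.
have hE1 x w : r x w = (h x *m w^T)^T by rewrite -[RHS](hE 1%N).
have hP x : h x = \matrix_(i, j) (r x (delta_mx 0 j) 0 i).
  by apply/matrixP => i j; rewrite !mxE.
have hl : linear h.
  by move=> a x y; apply/matrixP => i j; rewrite !hP !mxE rl !mxE.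
have hbr x y : h (br x y) = h x * h y - h y * h x.
  apply: trmx_inj; apply/row_matrixP => i; rewrite !rowE.
  have e M : delta_mx (0 : 'I_1) i *m M^T = (M *m (delta_mx 0 i)^T)^T :> 'rV[k]_n.+1.
    by rewrite trmx_mul trmxK.
  rewrite !e -hE1 rb !hE1 !trmxK.
  by rewrite mulmxBl linearB /= -!mulmxE !mulmxA.
have jac := jacobson_formula pk hl hbr.
have pR := pchar_alg pk 'M[k]_n.+1.
split=> [x y w|x y w].
  have rD u v : r (u + v) w = r u w + r v w.
    exact: (zmod_morphD (zmod_morphism_linear (rl w))).
  have rS (G : nat -> K) : r (\sum_(1 <= i < p) G i) w = \sum_(1 <= i < p) r (G i) w.
    exact: (zmod_morph_sum _ _ _ (zmod_morphism_linear (rl w))).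
  rewrite (pmapD hK) !hE jac !rD rS.
  rewrite !mulmxDl mulmx_suml !linearD linear_sum /=.
  have -> : \sum_(1 <= i < p) (h (jacobson_s p br x y i) *m w^T)^T =
            \sum_(1 <= i < p) r (jacobson_s p br x y i) w.
    by apply: eq_bigr => i _; rewrite hE1.
  by rewrite addrACA subrr addr0 addrACA.
have hpm : h (pm x) * h y - h y * h (pm x) = h x ^+ p * h y - h y * h x ^+ p.
  rewrite -hbr (pmap_ad hK) -[RHS](iter_ad_char pR).
  by elim: (p) => [//|m ih]; rewrite !iterS hbr ih.
rewrite !hE !hE1 !trmxK -!linearB /= -!mulmxBl trmxK.
rewrite !mulmxA !mulmxE; congr ((_ *m _)^T); rewrite mulrBl mulrBr.
rewrite -[h x ^+ p * h y](subrK (h y * h x ^+ p)) -hpm.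
by rewrite addrAC [_ - _ - _]addrAC subrr sub0r addrC.
Qed.

End Phi.

(** * Extension of scalars *)

Section Ext.
Variables (F Fbar : fieldType) (iota : {rmorphism F -> Fbar}).
Local Notation ext := (ext Fbar).
Local Notation emb := (emb iota).

Section One.
Variable K : vectType F.

Lemma emb_linear a (x y : K) : emb (a *: x + y) = iota a *: emb x + emb y.
Proof. by apply/rowP => i; rewrite !mxE linearP rmorphD rmorphM. Qed.

Lemma emb_basis (i : 'I_(\dim {:K})) : emb (vbasis {:K})`_i = delta_mx 0 i :> ext K.
Proof.
apply/rowP => j; rewrite !mxE (coord_free _ _ (basis_free (vbasisP _))) eqxx.
by rewrite rmorph_nat eq_sym.
Qed.

Lemma ext_decomp (u : ext K) : u = \sum_i u 0 i *: emb (vbasis {:K})`_i.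
Proof. by rewrite [LHS]row_sum_delta; apply: eq_bigr => i _; rewrite emb_basis. Qed.

(** Rational vectors span the extension; (semi)linear identities are thereby reduced to elements of
    K. *)
Lemma ext_ind (P : ext K -> Prop) :
  P 0 -> (forall a x u, P u -> P (a *: emb x + u)) -> forall u, P u.
Proof.
move=> P0 PS u; rewrite [u]ext_decomp; elim: (index_enum _) => [|i s ih].
  by rewrite big_nil.
by rewrite big_cons; apply: PS.
Qed.

Lemma emb_coord n (e : n.-tuple K) (U : {vspace K}) u : basis_of U e -> u \in U ->
  emb u = \sum_j iota (coord e j u) *: emb (tnth e j).
Proof.
move=> eU uU; have e0 : emb (0 : K) = 0 by apply/rowP => i; rewrite !mxE linear0 rmorph0.
rewrite {1}(coord_basis eU uU); elim: (index_enum _) => [|j r ih].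
  by rewrite !big_nil.
by rewrite !big_cons emb_linear ih (tnth_nth 0).
Qed.

Section Lin.
Variables (N : lmodType Fbar) (g : K -> N).

Lemma ext_lin_linear : linear (ext_lin g).
Proof.
move=> a u v; rewrite /ext_lin scaler_sumr -big_split; apply: eq_bigr => i _.
by rewrite !mxE scalerDl scalerA.
Qed.

Lemma ext_lin_emb x : (forall a x y, g (a *: x + y) = iota a *: g x + g y) ->
  ext_lin g (emb x) = g x.
Proof.
move=> gl; have g0 : g 0 = 0.
  by have := gl 1 0 0; rewrite scale1r addr0 rmorph1 scale1r -{1}[g 0]addr0 => /addrI.
rewrite {2}(coord_vbasis (memvf x)) /ext_lin.
elim: (index_enum _) => [|i s ih]; first by rewrite !big_nil g0.
by rewrite !big_cons gl -ih mxE.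
Qed.

End Lin.
End One.

Definition bilin (K M N : lmodType F) (g : K -> M -> N) :=
  (forall y, linear (g^~ y)) /\ (forall x, linear (g x)).

Section Bilin.
Variables (K M N : vectType F) (g : K -> M -> N).

Lemma ext_bilin_linearl v : linear ((ext_bilin iota g)^~ v).
Proof. exact: ext_lin_linear. Qed.

Lemma ext_bilin_linearr u : linear (ext_bilin iota g u).
Proof.
move=> a v w; rewrite /ext_bilin [LHS](eq_bigr (fun i => a *: (u 0 i *: 
  ext_lin (fun y : M => emb (g (vbasis {:K})`_i y)) v) + u 0 i *: 
  ext_lin (fun y : M => emb (g (vbasis {:K})`_i y)) w)); last first.
  by move=> i _; rewrite (ext_lin_linear _ a v w) scalerDr !scalerA mulrC.
by rewrite big_split /= -scaler_sumr.
Qed.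

Hypothesis gb : bilin g.

Lemma ext_bilin_emb x y : ext_bilin iota g (emb x) (emb y) = emb (g x y).
Proof.
have [gl gr] := gb.
have e u : ext_lin (fun z => emb (g u z)) (emb y) = emb (g u y).
  by apply: ext_lin_emb => a w z; rewrite gr emb_linear.
rewrite /ext_bilin; under eq_fun do rewrite e.
by apply: ext_lin_emb => a w z; rewrite (gl y) emb_linear.
Qed.

Lemma ext_bilin0l v : ext_bilin iota g 0 v = 0.
Proof. by rewrite (zmod_morph0 (zmod_morphism_linear (ext_bilin_linearl v))). Qed.

Lemma ext_bilin0r u : ext_bilin iota g u 0 = 0.
Proof. by rewrite (zmod_morph0 (zmod_morphism_linear (ext_bilin_linearr u))). Qed.

End Bilin.

Section LieModule.
Variables (K M : vectType F) (br : K -> K -> K) (rho : K -> M -> M).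
Hypothesis brb : bilin br.
Hypothesis hM : lie_module br rho.

Lemma lie_module_bilin : bilin rho.
Proof. by split; [exact: lmod_linearl hM | exact: lmod_linearr hM]. Qed.

Let rl := ext_bilin_linearl rho.
Let rr := ext_bilin_linearr rho.

(** The module identity is linear in x, y and w, so three inductions reduce it to rational
    vectors. *)
Lemma lie_module_ext : lie_module (ext_bilin iota br) (ext_bilin iota rho).
Proof.
have rb := lie_module_bilin.
split; [exact: rl | exact: rr | move=> x y w].
elim/ext_ind: x => [|a x x' ih].
  by rewrite !ext_bilin0l // ext_bilin0r // subrr.
rewrite !(ext_bilin_linearl _ _ a) !(ext_bilin_linearr _ _ a) ih.
rewrite -[RHS]/(_ - _) opprD addrACA -scalerBr; congr (_ *: _ + _) => {x' ih a}.
elim/ext_ind: y => [|a y y' ih].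
  by rewrite ext_bilin0r // !ext_bilin0l // ext_bilin0r // subrr.
rewrite !(ext_bilin_linearl _ _ a, ext_bilin_linearr _ _ a) ih.
rewrite opprD addrACA -scalerBr; congr (_ *: _ + _) => {y' ih a}.
elim/ext_ind: w => [|a w w' ih]; first by rewrite !ext_bilin0r // subrr.
rewrite !(ext_bilin_linearr _ _ a) ih.
rewrite opprD addrACA -scalerBr; congr (_ *: _ + _) => {w' ih a}.
rewrite !ext_bilin_emb // (lmod_br hM).
by rewrite -[- rho _ _]scaleN1r addrC emb_linear rmorphN1 scaleN1r addrC.
Qed.

End LieModule.

Section CharExt.
Variables (K : vectType F) (c : K -> Fbar).
Hypothesis cc : is_character iota c.

Lemma char_ext_linear a (u v : ext K) :
  char_ext c (a *: u + v) = a * char_ext c u + char_ext c v.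
Proof. exact: (@ext_lin_linear K Fbar^o c). Qed.

Lemma char_ext_emb x : char_ext c (emb x) = c x.
Proof. by apply: (@ext_lin_emb K Fbar^o c) => a y z; rewrite cc. Qed.
End CharExt.

Section Aut.
Variables (alpha : {rmorphism Fbar -> Fbar}) (hal : galois_aut iota alpha).

Definition map_ext (K : vectType F) (u : ext K) : ext K := map_mx alpha u.

Lemma map_extP (K : vectType F) a (u v : ext K) :
  map_ext (a *: u + v) = alpha a *: map_ext u + map_ext v.
Proof. by rewrite /map_ext map_mxD map_mxZ. Qed.

Lemma map_ext0 (K : vectType F) : map_ext (0 : ext K) = 0.
Proof. exact: map_mx0. Qed.

Lemma map_ext_emb (K : vectType F) (x : K) : map_ext (emb x) = emb x.
Proof. by apply/rowP => i; rewrite !mxE hal.2. Qed.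

Lemma map_ext_bilin (K M N : vectType F) (g : K -> M -> N) u v : bilin g ->
  map_ext (ext_bilin iota g u v) = ext_bilin iota g (map_ext u) (map_ext v).
Proof.
move=> gb; elim/ext_ind: u => [|a x u ih].
  by rewrite map_ext0 !ext_bilin0l // map_ext0.
rewrite map_extP !ext_bilin_linearl map_extP ih; congr (_ *: _ + _).
rewrite map_ext_emb; elim/ext_ind: v {u ih a} => [|a y v ih].
  by rewrite map_ext0 !ext_bilin0r // map_ext0.
rewrite map_extP !ext_bilin_linearr map_extP ih; congr (_ *: _ + _).
by rewrite map_ext_emb ext_bilin_emb // map_ext_emb.
Qed.

Lemma map_char_ext (K : vectType F) (c : K -> Fbar) u : is_character iota c ->
  alpha (char_ext c u) = char_ext (alpha \o c) (map_ext u).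
Proof.
move=> cc; rewrite /char_ext /ext_lin rmorph_sum; apply: eq_bigr => i _.
by rewrite mxE rmorphM.
Qed.

End Aut.

(** A p-map is determined by its values on a spanning set, through p-semilinearity and the Jacobson
    terms, which are Lie polynomials. This serves for the inclusion of S in L (alpha = id) and for
    the coordinatewise action of alpha. *)
Lemma pmap_compat (p : nat) (p0 : (0 < p)%N) (alpha : {rmorphism Fbar -> Fbar})
    (K : vectType F) (br : ext K -> ext K -> ext K) (pm : ext K -> ext K)
    (N : lmodType Fbar) (br' : N -> N -> N) (pm' : N -> N) (f : ext K -> N) :
  restricted_lie p br pm -> restricted_lie p br' pm' ->
  (forall a u v, f (a *: u + v) = alpha a *: f u + f v) ->
  (forall u v, f (br u v) = br' (f u) (f v)) ->
  (forall x, f (pm (emb x)) = pm' (f (emb x))) ->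
  forall u, f (pm u) = pm' (f u).
Proof.
move=> hK hN fP fbr fe.
have fB : zmod_morphism f.
  by move=> u v; rewrite addrC -scaleN1r fP rmorphN1 scaleN1r addrC.
have fZ a u : f (a *: u) = alpha a *: f u.
  by have := fP a u 0; rewrite (zmod_morph0 fB) !addr0.
have pm0 (V : lmodType Fbar) b q : @restricted_lie p Fbar V b q -> q 0 = 0.
  by move=> h; have := pmapZ h 0 0; rewrite expr0n gtn_eqF // !scale0r.
elim/ext_ind => [|a x u ih].
  by rewrite (pm0 _ _ _ hK) (zmod_morph0 fB) (pm0 _ _ _ hN).
rewrite (pmapD hK) fP (pmapD hN) !(zmod_morphD fB) ih; congr (_ + _ + _).
  by rewrite (pmapZ hK) fZ fe (pmapZ hN) rmorphXn.
rewrite (zmod_morph_sum _ _ _ fB); apply: eq_bigr => i _.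
(* The coefficient 1/i lies in the prime field, hence is fixed by alpha. *)
rewrite /jacobson_s fZ fmorphV rmorph_nat; congr (_ *: _).
elim: (p.-1) (i.-1) => [|m IH] j /=; first by case: j; rewrite ?(zmod_morph0 fB) ?fZ.
rewrite (zmod_morphD fB) fbr IH; congr (_ + _).
by case: j => [|j]; rewrite ?(zmod_morph0 fB) // fbr IH fZ.
Qed.

End Ext.

(** * Components of a module *)

Section Operators.
Variables (k : fieldType) (V : lmodType k).
Implicit Types (f g : V -> V).

Definition opshift f (a : k) (v : V) : V := f v - a *: v.

Lemma opshift_linear f a : linear f -> linear (opshift f a).
Proof.
move=> fl b u v; rewrite /opshift fl scalerDr !scalerA mulrC -scalerA opprD.
by rewrite addrACA -scalerBr.
Qed.

Lemma iter_comm f g m : (forall v, f (g v) = g (f v)) ->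
  forall v, iter m f (g v) = g (iter m f v).
Proof. by move=> fg v; elim: m => [//|m ih]; rewrite !iterS ih fg. Qed.

Lemma opshift_comm f g a : linear g -> (forall v, f (g v) = g (f v)) ->
  forall v, opshift f a (g v) = g (opshift f a v).
Proof.
by move=> gl fg v; rewrite /opshift fg (zmod_morphism_linear gl) (linear_scale gl).
Qed.

(** By induction on the exponents, (f - a)u and (f - b)u both vanish; their difference is (b - a)u
    up to sign. *)
Lemma opshift_coprime f a b m n u : linear f -> a != b ->
  iter m (opshift f a) u = 0 -> iter n (opshift f b) u = 0 -> u = 0.
Proof.
move=> fl ab; have al := opshift_linear a fl; have bl := opshift_linear b fl.
have ca v : opshift f a (f v) = f (opshift f a v) by apply: opshift_comm.
have cb v : opshift f b (f v) = f (opshift f b v) by apply: opshift_comm.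
have cab v : opshift f a (opshift f b v) = opshift f b (opshift f a v).
  exact: opshift_comm.
elim: m n u => [|m ihm] // n; elim: n => [|n ihn] // u ha hb.
have e1 : opshift f a u = 0.
  apply: (ihm n.+1); first by rewrite -iterSr.
  by rewrite iter_comm // hb (zmod_morph0 (zmod_morphism_linear al)).
have e2 : opshift f b u = 0.
  apply: ihn; last by rewrite -iterSr.
  by rewrite iter_comm // ha (zmod_morph0 (zmod_morphism_linear bl)).
have : opshift f b u - opshift f a u = 0 by rewrite e1 e2 subrr.
rewrite /opshift opprB addrC addrA subrK -scalerBl => /eqP.
by rewrite scaler_eq0 subr_eq0 (negbTE ab) /= => /eqP.
Qed.

(** One application of f + g gives f u + g u; each summand has one of its two exponents lowered by
    1. *)
Lemma iter_add_comm f g m n u : linear f -> linear g ->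
  (forall v, f (g v) = g (f v)) ->
  iter m f u = 0 -> iter n g u = 0 -> iter (m + n) (fun v => f v + g v) u = 0.
Proof.
move=> fl gl fg; set h := fun v => _.
have hl : linear h by move=> a x y; rewrite /h fl gl addrACA -scalerDr.
have h0 l : iter l h 0 = 0.
  by rewrite (zmod_morph0 (zmod_morphism_linear (iter_linear_fun _ hl))).
elim: m n u => [|m ihm] n; first by move=> u /= -> _; apply: h0.
elim: n => [|n ihn] u; first by move=> _ /= ->; apply: (h0 (m.+1 + 0)%N).
move=> hf hg; rewrite addnS iterSr.
have -> : iter (m.+1 + n) h (h u) = iter (m.+1 + n) h (f u) + iter (m.+1 + n) h (g u).
  by rewrite -(zmod_morphD (zmod_morphism_linear (iter_linear_fun _ hl))).
rewrite {1}addSnnS ihm ?ihn ?addr0 //.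
- by rewrite iter_comm // hf (zmod_morph0 (zmod_morphism_linear gl)).
- by rewrite -iterSr.
- by rewrite -iterSr.
by rewrite iter_comm // hg (zmod_morph0 (zmod_morphism_linear fl)).
Qed.

(** The last nonzero iterate of u under one operator is killed by it, and commutation keeps the
    others nilpotent there. P is arbitrary so that it can record the equations already achieved. *)
Lemma joint_kernel (I : eqType) (l : seq I) (f : I -> V -> V) (P : V -> Prop) u :
  (forall i, linear (f i)) -> (forall i j v, f i (f j v) = f j (f i v)) ->
  (forall i v, P v -> P (f i v)) -> P u -> u != 0 ->
  (forall i, i \in l -> exists r, iter r (f i) u = 0) ->
  exists v, [/\ v != 0, P v & forall i, i \in l -> f i v = 0].
Proof.
move=> fl fc; elim: l P u => [|i l ih] P u Pf Pu u0 nil; first by exists u.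
have [r hr] := nil i (mem_head _ _).
have [v1 [v10 Pv1 fv1 nv1]] : exists v1, [/\ v1 != 0, P v1, f i v1 = 0 &
    forall j, j \in l -> exists r, iter r (f j) v1 = 0].
  elim: r u Pu u0 nil hr => [|r IH] u Pu u0 nil hr.
    by rewrite /= in hr; rewrite hr eqxx in u0.
  have [e|ne] := eqVneq (f i u) 0.
    by exists u; split=> // j jl; apply: nil; rewrite inE jl orbT.
  apply: (IH (f i u)); rewrite -?iterSr //; first exact: Pf.
  move=> j jl; have [s hs] := nil j jl; exists s.
  by rewrite iter_comm // hs (zmod_morph0 (zmod_morphism_linear (fl i))).
have [||//|//|v [v0 [Pv fv] fl0]] := ih (fun v => P v /\ f i v = 0) v1.
- move=> j v [Pv e]; split; first exact: Pf.
  by rewrite fc e (zmod_morph0 (zmod_morphism_linear (fl j))).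
- by [].
exists v; split=> // j; rewrite inE => /orP[/eqP->//|]; exact: fl0.
Qed.

End Operators.

(** * Primary decomposition for commuting operators *)

Lemma closed_root (k : fieldType) (q : {poly k}) :
  GRing.closed_field_axiom k -> (1 < size q)%N -> exists a, root q a.
Proof.
move=> ck sq; have n0 : (0 < (size q).-1)%N by case: (size q) sq => [|[]].
have lq : lead_coef q != 0 by rewrite lead_coef_eq0 -size_poly_gt0 ltnW.
(* The axiom solves x^n = sum of P_i x^i for i < n; these are the coefficients of the monic multiple
   of q. *)
have [a ha] := ck _ (fun i => - q`_i / lead_coef q) n0; exists a.
rewrite /root horner_coef -[in X in X == 0](prednK (ltnW sq)).
rewrite big_ord_recr /= -lead_coefE ha mulr_sumr -big_split big1 //= => i _.
by rewrite mulrA mulrCA divff // mulr1 mulNr subrr.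
Qed.

Section PrimaryDecomposition.
Variables (k : fieldType) (ck : GRing.closed_field_axiom k).

(** An additive predicate D replaces an explicit direct sum. The summands are kept of the form g(T)
    w, so that operators commuting with T retain their generalised eigenvalue on them;
    [primary_decomp_seq] relies on this. *)
Lemma primary_decomp n (T : 'M[k]_n.+1) (D : 'rV[k]_n.+1 -> Prop) w :
  D 0 -> (forall u v, D u -> D v -> D (u + v)) ->
  (forall g a r, w *m horner_mx T g *m (T - a%:M) ^+ r = 0 -> D (w *m horner_mx T g)) ->
  D w.
Proof.
move=> D0 DD Dg.
(* Induction on the degree of an annihilator q of g(T) w: the full power of X - a is split off q,
   and a Bezout relation cuts the vector in two. *)
suff main q g : q != 0 -> w *m horner_mx T (g * q) = 0 -> D (w *m horner_mx T g).
  have -> : w = w *m horner_mx T 1 by rewrite rmorph1 mulmx1.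
  apply: (main (char_poly T)).
    by rewrite -size_poly_gt0 size_char_poly.
  by rewrite mul1r Cayley_Hamilton mulmx0.
have [m] := ubnP (size q); elim: m q g => // m ih q g sq q0 e.
have [s1|s1] := leqP (size q) 1.
  have [c cE] : exists c, q = c%:P by exists q`_0; apply: size1_polyC.
  move: e q0; rewrite cE polyC_eq0 mulrC mul_polyC linearZ /= -scalemxAr => /eqP e c0.
  by move: e; rewrite scalemx_eq0 (negbTE c0) /= => /eqP->.
have [a ra] := closed_root ck s1.
have [r [q1 rq1 qE]] := multiplicity_XsubC q a.
move: rq1; rewrite q0 /= => rq1.
have r0 : (0 < r)%N.
  by case: r qE => // qE; move: ra rq1; rewrite qE mulr1 => ->.
have q10 : q1 != 0 by apply: contraNneq rq1 => ->; rewrite root0.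
have cop : coprimep (('X - a%:P) ^+ r) q1.
  by rewrite coprimep_expl // coprimep_sym coprimep_XsubC.
have /Bezout_eq1_coprimepP[[x y] /= xy] := cop.
have -> : g = g * (x * ('X - a%:P) ^+ r) + g * (y * q1) by rewrite -mulrDr xy mulr1.
rewrite rmorphD mulmxDr; apply: DD.
  apply: (ih q1) => //.
    rewrite -ltnS; apply: leq_trans sq; rewrite ltnS qE.
    rewrite size_Mmonic ?monic_exp ?monicXsubC //.
    rewrite size_exp_XsubC addnS /=; case: (r) r0 => // r' _.
    by rewrite -[ltnLHS]addn0 ltn_add2l.
  have -> : g * (x * ('X - a%:P) ^+ r) * q1 = (g * q) * x by rewrite qE; ring.
  by rewrite rmorphM /= -mulmxE mulmxA e mul0mx.
apply: (Dg _ a r); rewrite -mulmxA mulmxE.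
have -> : (T - a%:M) ^+ r = horner_mx T (('X - a%:P) ^+ r).
  by rewrite rmorphXn rmorphB /= horner_mx_X horner_mx_C.
rewrite -rmorphM /=.
have -> : g * (y * q1) * ('X - a%:P) ^+ r = (g * q) * y by rewrite qE; ring.
by rewrite rmorphM /= -mulmxE mulmxA e mul0mx.
Qed.

Lemma primary_decomp_seq n (Ts : seq 'M[k]_n.+1) (D : 'rV[k]_n.+1 -> Prop) w :
  D 0 -> (forall u v, D u -> D v -> D (u + v)) ->
  {in Ts &, forall T T', T *m T' = T' *m T} ->
  (forall u, {in Ts, forall T, exists a r, u *m (T - a%:M) ^+ r = 0} -> D u) -> D w.
Proof.
move=> D0 DD; elim: Ts => [|T Ts ih] cT Du; first by apply: Du.
apply: ih => [T1 T2 h1 h2|u hu]; first by apply: cT; rewrite inE ?h1 ?h2 orbT.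
apply: (@primary_decomp _ T) => // g a r e; apply: Du => T'.
rewrite inE => /orP[/eqP->|hT']; first by exists a, r.
have [b [s hs]] := hu _ hT'; exists b, s.
have cTT' : T *m T' = T' *m T by apply: cT; rewrite inE ?eqxx ?hT' ?orbT.
rewrite -mulmxA.
suff -> : horner_mx T g *m (T' - b%:M) ^+ s = (T' - b%:M) ^+ s *m horner_mx T g.
  by rewrite mulmxA hs mul0mx.
apply: commrX; apply: commrB; last by apply: (comm_mx_scalar b (horner_mx T g)).
exact/comm_horner_mx/cTT'.
Qed.

End PrimaryDecomposition.

Lemma linear_pack (k : fieldType) (U V : lmodType k) (f : U -> V) :
  linear f -> exists g : {linear U -> V}, g =1 f.
Proof.
move=> fl; pose f0 := GRing.isLinear.Build _ _ _ _ f fl.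
pose f1 : {linear _ -> _} := HB.pack f f0.
by exists f1.
Qed.

Lemma comm_decomp (k : fieldType) (ck : GRing.closed_field_axiom k) d
    (I : eqType) (l : seq I) (f : I -> 'rV[k]_d -> 'rV[k]_d) (D : 'rV[k]_d -> Prop) w :
  (forall i, linear (f i)) -> (forall i j v, f i (f j v) = f j (f i v)) ->
  D 0 -> (forall u v, D u -> D v -> D (u + v)) ->
  (forall u, (forall i, i \in l -> exists a r, iter r (opshift (f i) a) u = 0) -> D u) ->
  D w.
Proof.
move=> fl fc D0 DD Du; case: d f D w fl fc D0 DD Du => [|n] f D w fl fc D0 DD Du.
  by rewrite thinmx0.
pose T i : 'M_n.+1 := lin1_mx (f i).
have TE i v : v *m T i = f i v.
  have [g gf] := linear_pack (fl i).
  rewrite -gf -mul_rV_lin1; congr (_ *m _); apply/matrixP => a b.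
  by rewrite !mxE gf.
apply: (@primary_decomp_seq k ck n [seq T i | i <- l]) => //.
  move=> _ _ /mapP[i _ ->] /mapP[j _ ->]; apply/row_matrixP => a.
  by rewrite !rowE !mulmxA !TE fc.
move=> u hu; apply: Du => i il; have [a [r e]] := hu _ (map_f T il); exists a, r.
rewrite -e; elim: r {e} => [|r ih]; first by rewrite expr0 mulmx1.
by rewrite iterS ih exprSr -mulmxE mulmxA mulmxBr TE mul_mx_scalar.
Qed.

(** Among the subspaces contained in P, one of maximal dimension contains every v in P, since
    adjoining v stays inside P. *)
Lemma pred_vspace (k : fieldType) (V : vectType k) (P : V -> Prop) :
  P 0 -> (forall a u v, P u -> P v -> P (a *: u + v)) ->
  exists U : {vspace V}, forall v, v \in U <-> P v.
Proof.
move=> P0 PD.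
pose Q d := `[< exists2 U : {vspace V}, \dim U = d & forall v, v \in U -> P v >].
have exQ : exists d, Q d.
  exists 0%N; apply/asboolP; exists 0%VS; first exact: dimv0.
  by move=> v; rewrite memv0 => /eqP->.
have bQ d : Q d -> (d <= \dim {:V})%N.
  by move=> /asboolP[U <- _]; apply/dimvS/subvf.
case: (ex_maxnP exQ bQ) => d /asboolP[U dU UP] dmax; exists U => v.
split; first exact: UP.
move=> Pv; pose U' := (U + <[v]>)%VS.
have QU' : Q (\dim U').
  apply/asboolP; exists U' => // _ /memv_addP[u uU [_ /vlineP[a ->] ->]].
  by rewrite addrC; apply: PD (UP _ uU).
have /eqP -> : (U == U')%VS by rewrite eqEdim addvSl dU dmax.
by rewrite (subvP (addvSr _ _)) // memv_line.
Qed.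

(** * Composition series *)

Section Composition.
Variables (F Fbar : fieldType) (iota : {rmorphism F -> Fbar}).
Variables (K M : vectType F) (rho : K -> M -> M).
Local Notation sub := (submodule iota rho).
Local Notation ext := (ext Fbar).

Lemma min_submodule (P : {vspace ext M} -> Prop) :
  (exists U, P U) -> exists2 U, P U & forall T, P T -> (\dim U <= \dim T)%N.
Proof.
move=> [U0 PU0]; pose Q d := `[< exists2 U, \dim U = d & P U >].
have exQ : exists d, Q d by exists (\dim U0); apply/asboolP; exists U0.
case: (ex_minnP exQ) => d /asboolP[U <- PU] dmin; exists U => // T PT.
by apply: dmin; apply/asboolP; exists T.
Qed.

(** Induction on the codimension: the next term is a submodule of least dimension among those
    strictly containing U. *)
Lemma composition_above (U : {vspace ext M}) : sub U ->
  exists m f, [/\ f 0 = U, f m = fullv, forall i, (i <= m)%N -> sub (f i) &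
    forall i, (i < m)%N -> irreducible_factor iota rho (f i) (f i.+1)].
Proof.
have [n] := ubnP (\dim {:ext M} - \dim U)%N; elim: n U => // n ih U dU sU.
have [Uf|Uf] := eqVneq U fullv; first by exists 0%N, (fun=> U).
have subf : sub fullv by move=> x u _; rewrite memvf.
have [|U' [sU' UU' nUU'] U'min] :=
    @min_submodule (fun T => [/\ sub T, (U <= T)%VS & U != T]).
  by exists fullv; rewrite subvf.
have ltUU' : (\dim U < \dim U')%N.
  by rewrite ltnNge; apply: contra nUU' => ?; rewrite eqEdim UU'.
have [|m [f [f0 fm fs fi]]] := ih U' _ sU'.
  rewrite -ltnS; apply: leq_trans dU; rewrite ltnS.
  by apply: ltn_sub2l => //; apply: leq_trans ltUU' (dimvS (subvf _)).
exists m.+1, (fun i => if i is j.+1 then f j else U); split=> //.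
  by case=> // i im; apply: fs.
case=> [_|i im]; last exact: fi.
split; [by rewrite f0| by rewrite f0; apply/eqP|] => T sT; rewrite f0 => /andP[UT TU'].
have [->|nUT] := eqVneq T U; [by left | right].
by apply/eqP; rewrite eqEdim TU' U'min // eq_sym.
Qed.

End Composition.

(** * Components, their independence, and the cluster *)

Section Components.
Variables (F Fbar : fieldType) (iota : {rmorphism F -> Fbar}) (p : nat).
Hypothesis pF : p \in [pchar F].
Hypothesis ck : GRing.closed_field_axiom Fbar.
Variables (K : vectType F) (br : K -> K -> K) (pm : K -> K).
Hypothesis brb : bilin br.
Variable pmb : ext Fbar K -> ext Fbar K.
Hypothesis hKb : is_ext_pmap iota p br pm pmb.
Variables (M : vectType F) (rho : K -> M -> M).
Hypothesis hM : lie_module br rho.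
Implicit Types (c : K -> Fbar) (x y : ext Fbar K) (u v w : ext Fbar M).

Local Notation emb := (emb iota).
Local Notation rhob := (ext_bilin iota rho).
Local Notation Phib := (phi p pmb rhob).
Local Notation comp c := (in_component iota p pm rho c).

Let pk : p \in [pchar Fbar]. Proof. by rewrite (fmorph_pchar iota). Qed.
Let hMb : lie_module (ext_bilin iota br) rhob. Proof. exact: lie_module_ext. Qed.
Let rr := lmod_linearr hMb.

(** Extends [phi_shift] from K to Fbar (x) K, where it is p-semilinear in x ([shiftP]). *)
Definition shift c x w := opshift (Phib x) (char_ext c x ^+ p) w.

Lemma shift_linear c x : linear (shift c x).
Proof. exact/opshift_linear/(phi_linear _ _ hMb). Qed.

Lemma frobD (a b : Fbar) : (a + b) ^+ p = a ^+ p + b ^+ p.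
Proof. by rewrite -!(pFrobenius_autE pk) rmorphD. Qed.

Lemma shift_emb c s w : is_character iota c ->
  shift c (emb s) w = phi_shift iota p pm rho c s w.
Proof. by move=> cc; rewrite /shift /opshift /phi (char_ext_emb cc) hKb.2. Qed.

Lemma shiftP c a x y w :
  shift c (a *: x + y) w = a ^+ p *: shift c x w + shift c y w.
Proof.
have [PD _] := phiD_phi_comm pk hKb.1 hMb.
rewrite /shift /opshift PD (phiZ hKb.1 hMb) char_ext_linear frobD exprMn.
by rewrite scalerDl opprD addrACA [in RHS]scalerBr scalerA.
Qed.

Lemma Phib_rho x y w : Phib x (rhob y w) = rhob y (Phib x w).
Proof. by have [_ ->] := phiD_phi_comm pk hKb.1 hMb. Qed.

(** Phi_y is a polynomial in module operators, with each of which phi_x commutes. *)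
Lemma Phib_comm x y w : Phib x (Phib y w) = Phib y (Phib x w).
Proof.
have e m v : Phib x (iter m (rhob y) v) = iter m (rhob y) (Phib x v).
  by elim: m => [//|m ih]; rewrite !iterS Phib_rho ih.
rewrite {2 3}/phi (zmod_morphism_linear (phi_linear p pmb hMb x)).
by congr (_ - _); [exact: e | exact: Phib_rho].
Qed.

Lemma shift_rho c x y w : shift c x (rhob y w) = rhob y (shift c x w).
Proof. by apply: opshift_comm => [|v]; [exact: rr | exact: Phib_rho]. Qed.

Lemma shift_Phib c x y w : shift c x (Phib y w) = Phib y (shift c x w).
Proof. by apply: opshift_comm => [|v]; [exact: phi_linear hMb _ | exact: Phib_comm]. Qed.

Lemma shift_comm c d x y w : shift c x (shift d y w) = shift d y (shift c x w).
Proof.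
by apply/esym/opshift_comm => [|v]; [exact: shift_linear | rewrite shift_Phib].
Qed.

Lemma iter_shift_emb c s r w : is_character iota c ->
  iter r (shift c (emb s)) w = iter r (phi_shift iota p pm rho c s) w.
Proof. by move=> cc; apply: eq_iter => v; apply: shift_emb. Qed.

Lemma shift0 c w : shift c 0 w = 0.
Proof.
have := shiftP c 1 0 0 w; rewrite scale1r addr0 expr1n scale1r.
by rewrite -{1}[shift _ _ _]addr0 => /addrI.
Qed.

Lemma componentP c w : is_character iota c ->
  (forall i : 'I_(\dim {:K}), exists r, iter r (shift c (emb (vbasis {:K})`_i)) w = 0) ->
  w \in comp c.
Proof.
(* Exponents of commuting operators add up along the basis, uniformly in s; the extra 1 serves the
   empty sum, where the operator is [shift c 0] = 0. *)
move=> cc /choice[r hr]; apply/asboolP; exists (\sum_i r i).+1 => s.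
rewrite -iter_shift_emb // [emb s](ext_decomp iota).
elim: (index_enum _) => [|i l ih]; first by rewrite !big_nil; apply: shift0.
rewrite !big_cons -addnS.
set x := _ *: _; set y := \sum_(j <- l) emb s 0 j *: emb _.
rewrite (@eq_iter _ _ (fun v => shift c x v + shift c y v)); last first.
  move=> v; have := shiftP c 1 x y v; rewrite scale1r => ->.
  by rewrite expr1n scale1r.
apply: iter_add_comm ih; try exact: shift_linear; first exact: shift_comm.
rewrite (@eq_iter _ _ (fun v => emb s 0 i ^+ p *: shift c (emb (vbasis {:K})`_i) v)).
  by rewrite iterZ ?hr ?scaler0 //; apply: shift_linear.
by move=> v; rewrite /x -[_ *: emb _]addr0 shiftP shift0 addr0.
Qed.

Lemma component_rho c x w : is_character iota c -> w \in comp c -> rhob x w \in comp c.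
Proof.
move=> cc /asboolP[r hr]; apply/asboolP; exists r => s.
rewrite -iter_shift_emb // iter_comm; last by move=> v; rewrite shift_rho.
by rewrite iter_shift_emb // hr (zmod_morph0 (zmod_morphism_linear (rr x))).
Qed.

Lemma component_shift c d x w :
  is_character iota c -> w \in comp c -> shift d x w \in comp c.
Proof.
move=> cc /asboolP[r hr]; apply/asboolP; exists r => s.
rewrite -iter_shift_emb // iter_comm; last by move=> v; rewrite shift_comm.
by rewrite iter_shift_emb // hr (zmod_morph0 (zmod_morphism_linear (shift_linear d x))).
Qed.

Lemma amenable_shift c x w : is_character iota c ->
  (forall s, phi_ext iota p pm rho s w = c s ^+ p *: w) -> shift c x w = 0.
Proof.
move=> cc hw; move: x; apply: (ext_ind (iota := iota)) => [|a s x ih].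
  exact: shift0.
by rewrite shiftP ih addr0 shift_emb // /phi_shift hw subrr scaler0.
Qed.

(** Choose s with c(s) different from d(s). A power of phi_s - c(s)^p kills u_c, so by induction it
    kills u_d too; a power of phi_s - d(s)^p also kills u_d, and c(s)^p differs from d(s)^p by
    injectivity of Frobenius. *)
Lemma component_uniq (l : seq (K -> Fbar)) (u : (K -> Fbar) -> ext Fbar M) :
  uniq l -> (forall c, c \in l -> is_character iota c) ->
  (forall c, c \in l -> u c \in comp c) ->
  \sum_(c <- l) u c = 0 -> forall c, c \in l -> u c = 0.
Proof.
elim: l u => // c l ih u /= /andP[cl ul] lc lu su.
have cc := lc c (mem_head _ _).
have zl d : d \in l -> u d = 0.
  move=> dl; have dc : is_character iota d by apply: lc; rewrite inE dl orbT.
  have [s cds] : exists s, c s != d s.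
    apply: contrapT => /forallNP h; move: cl; suff -> : c = d by rewrite dl.
    by apply/funext => s; have /negP := h s; rewrite negbK => /eqP.
  have /asboolP[r hr] := lu c (mem_head _ _).
  pose u' b := iter r (shift c (emb s)) (u b).
  have itl := iter_linear_fun r (shift_linear c (emb s)).
  have u'd : u' d = 0.
    apply: ih => // [b bl|b bl|]; first by apply: lc; rewrite inE bl orbT.
      have bc : is_character iota b by apply: lc; rewrite inE bl orbT.
      rewrite /u'; elim: (r) => [|m IH]; first by apply: lu; rewrite inE bl orbT.
      by rewrite iterS; apply: component_shift.
    rewrite -(zmod_morph_sum _ _ _ (zmod_morphism_linear itl)).
    move: su; rewrite big_cons => /eqP; rewrite addrC addr_eq0 => /eqP->.
    by rewrite -scaleN1r (linear_scale itl) iter_shift_emb // hr scaler0.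
  have /asboolP[m hm] : u d \in comp d by apply: lu; rewrite inE dl orbT.
  apply: (opshift_coprime (phi_linear _ _ hMb (emb s)) _ u'd (n := m) (b := d s ^+ p)).
    rewrite (char_ext_emb cc); apply: contra cds => /eqP e; apply/eqP.
    by apply: (@fmorph_inj _ _ (pFrobenius_aut pk)); exact: e.
  by rewrite -(char_ext_emb dc) [LHS](iter_shift_emb _ _ _ dc) hm.
move=> d; rewrite inE => /orP[/eqP->|]; last exact: zl.
by move: su; rewrite big_cons big_seq big1 ?addr0 // => b; apply: zl.
Qed.

(* The vectors on which phi_s = c(s)^p for all s form a nonzero submodule; a   *)
(* composition series starting with a minimal submodule of it exhibits c.     *)
Lemma component_cluster c w : is_character iota c -> w \in comp c -> w != 0 ->
  module_cluster iota p pm rho c.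
Proof.
move=> cc wc w0; split=> //.
have [||||||v [v0 _ hv]] := @joint_kernel _ _ _ (enum 'I_(\dim {:K}))
    (fun i => shift c (emb (vbasis {:K})`_i)) (fun=> True) w => //.
- by move=> i; apply: shift_linear.
- by move=> *; apply: shift_comm.
- move=> i _; have /asboolP[r hr] := wc; exists r.
  by rewrite iter_shift_emb.
have shv x : shift c x v = 0.
  rewrite [x](ext_decomp iota); elim: (index_enum _) => [|i l ih].
    by rewrite big_nil shift0.
  by rewrite big_cons shiftP ih hv ?mem_enum // scaler0 addr0.
have [||X hX] := @pred_vspace _ (ext Fbar M) (fun v => forall x, shift c x v = 0).
- by move=> x; rewrite (zmod_morph0 (zmod_morphism_linear (shift_linear c x))).
- by move=> a u1 u2 h1 h2 x; rewrite shift_linear h1 h2 scaler0 addr0.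
have sX : submodule iota rho X.
  move=> x u /hX h; apply/hX => y; rewrite shift_rho h.
  by rewrite (zmod_morph0 (zmod_morphism_linear (rr x))).
have [|U [sU UX U0] Umin] := @min_submodule _ _ M
    (fun T => [/\ submodule iota rho T, (T <= X)%VS & T != 0%VS]).
  exists X; split=> //; apply: contraNneq v0 => X0.
  by rewrite -memv0 -X0; apply/hX.
have [m [f [f0 fm fs fi]]] := composition_above sU.
exists m.+1, (fun i => if i is j.+1 then f j else 0%VS), 0; split=> //; last first.
  move=> s u; rewrite f0 => /(subvP UX)/hX/(_ (emb s)).
  by rewrite shift_emb // /phi_shift => ->; rewrite mem0v.
split=> // [[_ x u|i im]|[_|i im]]; last 1 first.
- exact: fi.
- by rewrite memv0 => /eqP->; rewrite ext_bilin0r mem0v.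
- exact: fs.
rewrite f0; split; [exact: sub0v | by move=> e; rewrite -e eqxx in U0 |].
move=> T sT /andP[_ TU]; have [->|T0] := eqVneq T 0%VS; [by left | right].
apply/eqP; rewrite eqEdim TU Umin //; split=> //; exact: subv_trans UX.
Qed.

(** The phi of basis elements commute, so vectors decompose into joint generalised eigenvectors. The
    p-th roots of the eigenvalues, taken as values on the basis, define a character whose component
    contains the vector; [component_cluster] puts it in the cluster. *)
Lemma component_decomp (D : ext Fbar M -> Prop) w :
  D 0 -> (forall u v, D u -> D v -> D (u + v)) ->
  (forall c u, module_cluster iota p pm rho c -> u \in comp c -> D u) -> D w.
Proof.
move=> D0 DD Dc.
apply: (@comm_decomp _ ck _ _ (enum 'I_(\dim {:K}))
  (fun i => Phib (emb (vbasis {:K})`_i))) => //.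
- by move=> i; apply: phi_linear hMb _.
- by move=> *; apply: Phib_comm.
move=> u hu; have [->//|u0] := eqVneq u 0.
have /choice[b hb] (i : 'I_(\dim {:K})) : exists b, exists r,
    iter r (opshift (Phib (emb (vbasis {:K})`_i)) (b ^+ p)) u = 0.
  have [a [r h]] := hu i (mem_enum _ _).
  have p0 : (0 < p)%N by rewrite prime_gt0 // (pcharf_prime pF).
  (* A p-th root of a, from the equation x^p = a. *)
  have [b hb] := ck (fun i => if i == 0 then a else 0) p0.
  exists b, r; rewrite hb -[in X in iter r (opshift _ X)](prednK p0).
  rewrite big_ord_recl /= expr0 mulr1 big1 ?addr0 //.
  by move=> j _; rewrite mul0r.
pose c (s : K) := \sum_i iota (coord (vbasis {:K}) i s) * b i.
have cc : is_character iota c.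
  move=> a s t; rewrite -[RHS]/(iota a * c s + c t) /c mulr_sumr -big_split.
  apply: eq_bigr => i _.
  by rewrite linearP rmorphD rmorphM mulrDl mulrA.
have ci (i : 'I_(\dim {:K})) : c (vbasis {:K})`_i = b i.
  rewrite /c (bigD1 i) //= (coord_free _ _ (basis_free (vbasisP _))) eqxx rmorph1 mul1r.
  rewrite big1 ?addr0 // => j ji.
  by rewrite (coord_free _ _ (basis_free (vbasisP _))) eq_sym (negbTE ji) rmorph0 mul0r.
have uc : u \in comp c.
  apply: componentP => // i; have [r hr] := hb i; exists r.
  by rewrite -hr; apply: eq_iter => v; rewrite /shift (char_ext_emb cc) ci.
exact: Dc (component_cluster cc uc u0) uc.
Qed.

End Components.

(** * Spanning by ordered monomials *)

Section Spanning.
Variables (k : fieldType) (p : nat) (p1 : (1 < p)%N).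
Variables (K : lmodType k) (br : K -> K -> K) (pm : K -> K) (c : K -> k).
Variables (A : assocAlg k) (gen : K -> A).
Hypothesis genD : forall a x y, gen (a *: x + y) = alg_scal A a * gen x + gen y.
Hypothesis genM : forall x y, gen x * gen y = gen y * gen x + gen (br x y).
Hypothesis genX : forall x, gen x ^+ p = gen (pm x) + alg_scal A (c x ^+ p).
Variables (T : Type) (M V : lmodType k) (act : T -> M -> M) (incl : T -> K).
Variable pur : A -> M -> V.
Hypothesis purD : forall a b m, pur (a + b) m = pur a m + pur b m.
Hypothesis purZ : forall l a m, pur (alg_scal A l * a) m = l *: pur a m.
Hypothesis pur_act : forall a t m, pur (a * gen (incl t)) m = pur a (act t m).
Variables (n : nat) (e : 'I_n -> K).
Hypothesis gens : forall x, exists (l : 'I_n -> k) t, x = \sum_j l j *: e j + incl t.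
Variable P : V -> Prop.
Hypothesis PD : forall u v, P u -> P v -> P (u + v).
Hypothesis PZ : forall a u, P u -> P (a *: u).
Hypothesis Pmon : forall (r : {ffun 'I_n -> 'I_p}) m,
  P (pur (\prod_j gen (e j) ^+ r j) m).

(** The quantification over m lets a final factor from the subalgebra be absorbed into m. *)
Let Q a := forall m, P (pur a m).
Let pr (s : seq K) : A := \prod_(x <- s) gen x.

Let QD a b : Q a -> Q b -> Q (a + b).
Proof. by move=> qa qb m; rewrite purD; apply: PD. Qed.
Let QZ l a : Q a -> Q (alg_scal A l * a).
Proof. by move=> qa m; rewrite purZ; apply: PZ. Qed.

Let pr_cat s t : pr (s ++ t) = pr s * pr t. Proof. exact: big_cat. Qed.
Let pr_cons x s : pr (x :: s) = gen x * pr s. Proof. exact: big_cons. Qed.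

Let Q_expand s1 x s2 (l : 'I_n -> k) t : x = \sum_j l j *: e j + incl t ->
  (forall j, Q (pr (s1 ++ e j :: s2))) -> Q (pr (s1 ++ incl t :: s2)) ->
  Q (pr (s1 ++ x :: s2)).
Proof.
move=> -> he ht; elim: (index_enum _) => [|j r ih]; first by rewrite big_nil add0r.
rewrite big_cons -addrA pr_cat pr_cons genD mulrDl mulrDr; apply: QD.
  by rewrite -mulrA mulrA -alg_scalC -mulrA -pr_cons -pr_cat; apply: QZ.
by rewrite -pr_cons -pr_cat.
Qed.

(* Modulo products of smaller length the factors commute, factors from the     *)
(* subalgebra are absorbed by M, and p-th powers are shortened by genX.        *)
Section Step.
Variable N : nat.
Hypothesis IH : forall s, (size s < N)%N -> Q (pr s).

Let swap s1 x y s2 : (size (s1 ++ x :: y :: s2) <= N)%N ->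
  Q (pr (s1 ++ y :: x :: s2)) -> Q (pr (s1 ++ x :: y :: s2)).
Proof.
move=> sN q; have -> : pr (s1 ++ x :: y :: s2) =
    pr (s1 ++ y :: x :: s2) + pr (s1 ++ br x y :: s2).
  by rewrite !pr_cat !pr_cons !mulrA -[pr s1 * gen x * _]mulrA genM mulrDr mulrDl !mulrA.
apply: QD => //; apply: IH; move: sN; rewrite !size_cat /=.
by rewrite !addnS.
Qed.

Let push s0 x s1 s2 : (size (s0 ++ x :: s1 ++ s2) <= N)%N ->
  Q (pr (s0 ++ s1 ++ x :: s2)) -> Q (pr (s0 ++ x :: s1 ++ s2)).
Proof.
elim: s1 s0 => [//|y s1 ih] s0 /= sN q; apply: swap => //.
rewrite -cat_rcons; apply: ih; rewrite cat_rcons //.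
by move: sN; rewrite !size_cat /= !addnS.
Qed.

Let Q_perm s t s0 : (size (s0 ++ s) <= N)%N -> perm_eq s t ->
  Q (pr (s0 ++ t)) -> Q (pr (s0 ++ s)).
Proof.
elim: s t s0 => [|x s ih] t s0 sN.
  by move=> /perm_size /esym /eqP; rewrite size_eq0 => /eqP->.
move=> st; have xt : x \in t by rewrite -(perm_mem st) mem_head.
case/splitPr: xt st => t1 t2 st q.
have st' : perm_eq s (t1 ++ t2).
  by move: st; rewrite -(cat1s x t2) perm_sym perm_catCA /= perm_cons perm_sym.
rewrite -cat_rcons; apply: (ih _ _ _ st'); first by rewrite cat_rcons.
rewrite cat_rcons; apply: push => //.
by move: sN; rewrite !size_cat /= (perm_size st') size_cat.
Qed.

Let pr_nseq m x : pr (nseq m x) = gen x ^+ m.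
Proof. by elim: m => [|m ih]; rewrite ?[pr _]big_nil //= pr_cons ih exprS. Qed.

Let Q_basis (js : seq 'I_n) : (size js <= N)%N -> Q (pr (map e js)).
Proof.
move=> sN; have [lt|] := boolP [forall j, (count_mem j js < p)%N].
  have lt' j : (count_mem j js < p)%N by apply: (forallP lt).
  (* The indices of js sorted, so that the product over t is an ordered monomial. *)
  pose t := flatten [seq nseq (count_mem j js) j | j <- index_enum 'I_n].
  have st : perm_eq js t.
    apply/allP => j _ /=; apply/eqP; rewrite /t count_flatten -map_comp sumnE big_map.
    rewrite (bigD1 j) //= count_nseq /= eqxx mul1n big1 ?addn0 // => i ij.
    by rewrite count_nseq /= (negbTE ij).
  apply: (@Q_perm _ (map e t) [::]); rewrite ?size_map //=; first exact: perm_map.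
  pose r : {ffun 'I_n -> 'I_p} := [ffun j => Ordinal (lt' j)].
  have -> : pr (map e t) = \prod_j gen (e j) ^+ r j; last by move=> m; apply: Pmon.
  rewrite /t map_flatten -map_comp [LHS]big_flatten big_map /=.
  apply: eq_bigr => j _; rewrite map_nseq [LHS]pr_nseq /r ffunE; by [].
rewrite negb_forall => /existsP[j]; rewrite -leqNgt => pj.
pose rest := nseq (count_mem j js - p) j ++ [seq i <- js | predC1 j i].
have st : perm_eq js (nseq p j ++ rest).
  rewrite /rest catA -nseqD subnKC // perm_sym.
  have <- : [seq i <- js | pred1 j i] = nseq (count_mem j js) j.
    have : all (pred1 j) [seq i <- js | pred1 j i] by apply: filter_all.
    by move=> /all_pred1P ->; rewrite size_filter.
  by rewrite perm_filterC.
apply: (@Q_perm _ (map e (nseq p j ++ rest)) [::]); rewrite ?size_map //=.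
  exact: perm_map.
have := perm_size st; rewrite size_cat size_nseq => sr.
(* The p equal factors become one generator plus a scalar; both resulting words are shorter, as p >
   1. *)
rewrite map_cat map_nseq pr_cat pr_nseq genX mulrDl; apply: QD.
  rewrite -pr_cons; apply: IH; rewrite /= size_map.
  by apply: leq_trans sN; rewrite sr -addn2 addnC leq_add2r.
apply/QZ/IH; rewrite size_map; apply: leq_trans sN; rewrite sr -add1n leq_add2r.
exact: ltnW.
Qed.

Let val (g : 'I_n + T) : K := match g with inl j => e j | inr t => incl t end.

Let Q_gens (gs : seq ('I_n + T)) : (size gs <= N)%N -> Q (pr (map val gs)).
Proof.
have [[g1 [t [g2 ->]]]|[js ->]] : (exists g1 t g2, gs = g1 ++ inr t :: g2) \/
    exists js, gs = map inl js.
- elim: gs => [|[j|t] gs ih]; first by right; exists [::].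
    case: ih => [[g1 [t [g2 ->]]]|[js ->]]; first by left; exists (inl j :: g1), t, g2.
    by right; exists (j :: js).
  by left; exists [::], t, gs.
- rewrite map_cat /= => sN; pose s := map val g1 ++ map val g2.
  apply: (@Q_perm _ (s ++ [:: incl t]) [::]).
  + by move: sN; rewrite /= !size_cat /= !size_map.
  + by rewrite -cat1s perm_catCA perm_catC.
  move=> m; rewrite /= pr_cat [pr [:: _]]big_seq1 pur_act; apply: IH.
  by apply: leq_trans sN; rewrite /s !size_cat !size_map /= addnS.
rewrite size_map => sN; rewrite -map_comp; exact: Q_basis.
Qed.

Lemma Q_step s : (size s <= N)%N -> Q (pr s).
Proof.
(* Here gs is the prefix whose factors are already expanded into cobasis and subalgebra elements. *)
suff main gs : (size gs + size s <= N)%N -> Q (pr (map val gs ++ s)).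
  exact: (main [::]).
elim: s gs => [|x s ih] gs; first by rewrite cats0 addn0; apply: Q_gens.
rewrite addnS -addSn => sN; have [l [t xE]] := gens x; apply: (Q_expand xE) => [j|].
  by have := ih (rcons gs (inl j)); rewrite map_rcons size_rcons cat_rcons; apply.
by have := ih (rcons gs (inr t)); rewrite map_rcons size_rcons cat_rcons; apply.
Qed.

End Step.

Lemma PBW_spanning s m : P (pur (\prod_(x <- s) gen x) m).
Proof.
suff main N : forall t, (size t < N)%N -> Q (pr t) by apply: (main (size s).+1).
elim: N => // N ih t; rewrite ltnS; exact: Q_step.
Qed.

End Spanning.

(** * Induced modules and the Galois action *)

Lemma restricted_bilin (p : nat) (k : fieldType) (K : lmodType k) br (pm : K -> K) :
  restricted_lie p br pm -> bilin br.
Proof. by move=> h; split; [exact: lie_linearl h | exact: lie_linearr h]. Qed.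

Lemma sum_single (I : finType) (V : nmodType) (f : I -> V) i :
  (forall j, j != i -> f j = 0) -> \sum_j f j = f i.
Proof. by move=> f0; rewrite (bigD1 i) //= big1 ?addr0. Qed.

(* A semilinear homomorphism into A is a linear one into the twist of A, which *)
(* gives access to reduced_hom.                                                *)
Definition twisted_alg (k : fieldType) (alpha : {rmorphism k -> k}) (A : assocAlg k) :
  assocAlg k := @AssocAlg k A (alg_scal A \o alpha) (fun a x => alg_scalC (alpha a) x).

Section Induced.
Variables (F Fbar : fieldType) (iota : {rmorphism F -> Fbar}) (p : nat).
Hypothesis pF : p \in [pchar F].
Hypothesis ck : GRing.closed_field_axiom Fbar.
Variables (L : vectType F) (br : L -> L -> L) (pm : L -> L).
Hypothesis hL : restricted_lie p br pm.
Variable pmLb : ext Fbar L -> ext Fbar L.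
Hypothesis hLb : is_ext_pmap iota p br pm pmLb.
Variable S : {vspace L}.
Hypothesis hS : p_subalgebra br pm S.
Variable pmSb : ext Fbar (subvs_of S) -> ext Fbar (subvs_of S).
Hypothesis hSb : is_ext_pmap iota p (sub_br br S) (sub_pm pm S) pmSb.
Variables (W : vectType F) (rho : subvs_of S -> W -> W).
Hypothesis hW : lie_module (sub_br br S) rho.

Local Notation K := (subvs_of S).
Local Notation sbr := (sub_br br S).
Local Notation spm := (sub_pm pm S).
Local Notation brL := (ext_bilin iota br).
Local Notation brS := (ext_bilin iota sbr).
Local Notation rhob := (ext_bilin iota rho).
Local Notation emb := (emb iota).
Local Notation incl := (@ext_incl F Fbar iota L S).
Local Notation uL c := (uL iota p br pmLb c).
Local Notation uS c := (uS iota p br pmSb (S := S) c).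
Local Notation gL c := (@uL_gen F Fbar iota p L br pmLb c).
Local Notation comp c := (in_component iota p spm rho (char_res S c)).
Local Notation Wc c := (W_component iota p pm rho c).
Local Notation ind c := (@induced F Fbar iota p L br pm S pmLb pmSb W rho c).
Local Notation ipure c := (@induced_pure F Fbar iota p L br pm S pmLb pmSb W rho c).

Let p0 : (0 < p)%N. Proof. by rewrite prime_gt0 // (pcharf_prime pF). Qed.
Let p1 : (1 < p)%N. Proof. by rewrite prime_gt1 // (pcharf_prime pF). Qed.

Let brb : bilin br. Proof. exact: restricted_bilin hL. Qed.

Lemma vsval_sub_br s t : vsval (sbr s t) = br (vsval s) (vsval t).
Proof. by rewrite vsprojK // hS.1 // subvsP. Qed.

Lemma vsval_sub_pm s : vsval (spm s) = pm (vsval s).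
Proof. by rewrite vsprojK // hS.2 // subvsP. Qed.

Lemma sub_br_bilin : bilin sbr.
Proof.
split=> s a x y; rewrite /sub_br.
  by rewrite -linearP -brb.1 linearP.
by rewrite -linearP -brb.2 linearP.
Qed.

Lemma incl_linear : linear incl. Proof. exact: ext_lin_linear. Qed.

Lemma incl_emb s : incl (emb s) = emb (vsval s).
Proof. by apply: ext_lin_emb => a x y; rewrite linearP emb_linear. Qed.

Lemma incl_br s t : incl (brS s t) = brL (incl s) (incl t).
Proof.
have i0 : incl 0 = 0 by rewrite (zmod_morph0 (zmod_morphism_linear incl_linear)).
move: s; apply: (ext_ind (iota := iota)) => [|a x s ih].
  by rewrite ext_bilin0l i0 ext_bilin0l.
rewrite ext_bilin_linearl !incl_linear ext_bilin_linearl ih; congr (_ *: _ + _).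
move: t {s ih a}; apply: (ext_ind (iota := iota)) => [|a y t ih].
  by rewrite ext_bilin0r i0 ext_bilin0r.
rewrite ext_bilin_linearr !incl_linear ext_bilin_linearr ih; congr (_ *: _ + _).
by rewrite (ext_bilin_emb _ sub_br_bilin) !incl_emb (ext_bilin_emb _ brb) vsval_sub_br.
Qed.

Lemma incl_pm s : incl (pmSb s) = pmLb (incl s).
Proof.
apply: (pmap_compat (iota := iota) p0 (alpha := idfun) hSb.1 hLb.1 incl_linear incl_br).
by move=> x; rewrite hSb.2 !incl_emb hLb.2 vsval_sub_pm.
Qed.

Lemma char_res_character c : is_character iota c -> is_character iota (char_res S c).
Proof. by move=> cc a x y; rewrite -[LHS]/(c (vsval (a *: x + y))) linearP cc. Qed.

Lemma char_ext_incl c s : is_character iota c ->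
  char_ext (char_res S c) s = char_ext c (incl s).
Proof.
move=> cc; move: s; apply: (ext_ind (iota := iota)) => [|a x s ih].
  have i0 : incl 0 = 0 by rewrite (zmod_morph0 (zmod_morphism_linear incl_linear)).
  rewrite i0 /char_ext /ext_lin !big1 // => i _; by rewrite mxE scale0r.
rewrite char_ext_linear incl_linear char_ext_linear ih incl_emb !char_ext_emb //.
exact: char_res_character.
Qed.

(** * The induced module for one character *)

Section OneCharacter.
Variable c : L -> Fbar.
Hypothesis cc : is_character iota c.
Hypothesis cam : forall w, w \in comp c ->
  forall s, phi_ext iota p spm rho s w = c (vsval s) ^+ p *: w.

Let h (s : ext Fbar K) : uL c := gL c (incl s).

Let hD a x y : h (a *: x + y) = alg_scal (uL c) a * h x + h y.
Proof. by rewrite /h incl_linear; apply: red_genD. Qed.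

Let hbr x y : h (brS x y) = h x * h y - h y * h x.
Proof. by rewrite /h incl_br [X in X - _]red_genM addrC addKr. Qed.

Let hpm x : h x ^+ p = h (pmSb x) + alg_scal (uL c) (char_ext (char_res S c) x ^+ p).
Proof. by rewrite /h incl_pm char_ext_incl //; apply: red_genX. Qed.

Lemma uS_to_uL_gen s :
  uS_to_uL pmLb (reduced_gen p brS pmSb (char_ext (char_res S c)) s) = gL c (incl s).
Proof. exact: (reduced_hom_gen hD hbr hpm). Qed.

Lemma uS_to_uL_scal a : uS_to_uL pmLb (alg_scal (uS c) a) = alg_scal (uL c) a.
Proof. exact: (reduced_hom_scal hD hbr hpm). Qed.

Lemma uS_to_uLM (u v : uS c) : uS_to_uL pmLb (u * v) = uS_to_uL pmLb u * uS_to_uL pmLb v.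
Proof. exact: (reduced_homM hD hbr hpm). Qed.

Lemma uS_to_uLD (u v : uS c) : uS_to_uL pmLb (u + v) = uS_to_uL pmLb u + uS_to_uL pmLb v.
Proof. exact: (zmod_morphD (reduced_homB hD hbr hpm)). Qed.

Local Notation cact := (@comp_act F Fbar iota p K spm W rho (char_res S c)).

Lemma comp_valP (w : Wc c) : comp_val w \in comp c.
Proof. by case: w. Qed.

Lemma comp_val_insubd (u : ext Fbar W) :
  u \in comp c -> comp_val (insubd (0 : Wc c) u) = u.
Proof. by move=> uc; apply: (insubdK (0 : Wc c)). Qed.

Lemma comp_val_linear : linear (@comp_val F Fbar iota p K spm W rho (char_res S c)).
Proof. by []. Qed.

Lemma comp_val_inj : injective (@comp_val F Fbar iota p K spm W rho (char_res S c)).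
Proof. exact: val_inj. Qed.

Lemma comp_actE x w : comp_val (cact x w) = rhob x (comp_val w).
Proof.
apply: comp_val_insubd; apply: (component_rho pF sub_br_bilin hSb hW) (comp_valP w).
exact: char_res_character.
Qed.

Let act_lin x : linear (cact x).
Proof.
move=> a u v; apply: comp_val_inj.
by rewrite comp_actE !comp_val_linear !comp_actE ext_bilin_linearr.
Qed.

Let actD a x y v : cact (a *: x + y) v = a *: cact x v + cact y v.
Proof.
apply: comp_val_inj.
by rewrite comp_actE comp_val_linear !comp_actE ext_bilin_linearl.
Qed.

Let hWb : lie_module brS rhob. Proof. exact: lie_module_ext sub_br_bilin hW. Qed.

Let actbr x y v : cact (brS x y) v = cact x (cact y v) - cact y (cact x v).
Proof.
apply: comp_val_inj; rewrite (zmod_morphism_linear comp_val_linear) !comp_actE.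
exact: (lmod_br hWb).
Qed.

(** Amenability enters here: it gives the relation for x in S, and [amenable_shift] extends it to
    Fbar (x) S. Hence the reduced algebra acts on the component. *)
Let actpm x v : iter p (cact x) v = cact (pmSb x) v + char_ext (char_res S c) x ^+ p *: v.
Proof.
apply: comp_val_inj; rewrite (zmod_morphD (zmod_morphism_linear comp_val_linear)).
rewrite (linear_scale comp_val_linear) comp_actE.
have -> m : comp_val (iter m (cact x) v) = iter m (rhob x) (comp_val v).
  by elim: m => [//|m ih]; rewrite !iterS comp_actE ih.
apply/eqP; rewrite -subr_eq0 opprD addrA; apply/eqP.
apply: (@amenable_shift _ _ iota _ pF _ _ spm sub_br_bilin _ hSb _ _ hW) => //.
  exact: char_res_character.
by move=> s; apply: cam; apply: comp_valP.
Qed.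

Lemma uS_act_gen s w :
  uS_act (pm := pm) (rho := rho) (reduced_gen p brS pmSb (char_ext (char_res S c)) s) w
  = cact s w.
Proof. exact: (reduced_act_gen act_lin actD actbr actpm). Qed.

Lemma uS_act_scal a w :
  uS_act (pm := pm) (rho := rho) (alg_scal (uS c) a) w = a *: w.
Proof. exact: (reduced_act_scal act_lin actD actbr actpm). Qed.

Lemma uS_actM (u v : uS c) w :
  uS_act (pm := pm) (rho := rho) (u * v) w = uS_act u (uS_act v w).
Proof. exact: (reduced_actM act_lin actD actbr actpm). Qed.

Lemma uS_actD (u v : uS c) w :
  uS_act (pm := pm) (rho := rho) (u + v) w = uS_act u w + uS_act v w.
Proof. exact: (zmod_morphD (reduced_actB act_lin actD actbr actpm w)). Qed.

Lemma ipure_incl a s w : ipure c (a * gL c (incl s)) w = ipure c a (cact s w).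
Proof. by rewrite -uS_to_uL_gen -uS_act_gen; apply: pure_bal. Qed.

(** The tensor relations mention scalars only on the left; a scalar on the right crosses over as an
    element of u(S,c). *)
Lemma ipureZr a l w : ipure c a (l *: w) = l *: ipure c a w.
Proof.
rewrite -uS_act_scal -[LHS]pure_bal uS_to_uL_scal -alg_scalC; exact: pureZl.
Qed.


Lemma ipure_spanning n (e : n.-tuple L) : cobasis S e -> forall t : ind c,
  exists w : {ffun 'I_n -> 'I_p} -> Wc c,
    t = \sum_r ipure c (PBW_monomial iota br pmLb e c r) (w r).
Proof.
move=> he; pose P (t : ind c) := exists w : {ffun 'I_n -> 'I_p} -> Wc c,
    t = \sum_r ipure c (PBW_monomial iota br pmLb e c r) (w r).
have pDr a w w' : ipure c a (w + w') = ipure c a w + ipure c a w' by apply: pureDr.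
have pDl a a' w : ipure c (a + a') w = ipure c a w + ipure c a' w by apply: pureDl.
have pZl l a w : ipure c (alg_scal (uL c) l * a) w = l *: ipure c a w by apply: pureZl.
have p00 a : ipure c a 0 = 0 by rewrite -(scale0r 0) ipureZr scale0r.
have P0 : P 0 by exists (fun=> 0); rewrite big1.
have PD u v : P u -> P v -> P (u + v).
  move=> [w ->] [w' ->]; exists (fun r => w r + w' r).
  by rewrite -big_split; apply: eq_bigr => r _; rewrite pDr.
have PZ a u : P u -> P (a *: u).
  move=> [w ->]; exists (fun r => a *: w r).
  by rewrite scaler_sumr; apply: eq_bigr => r _; rewrite ipureZr.
have Pmon (r : {ffun 'I_n -> 'I_p}) m :
    P (ipure c (\prod_j gL c (emb (tnth e j)) ^+ r j) m).
  exists (fun r' => if r' == r then m else 0).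
  rewrite (sum_single (i := r)) ?eqxx // => r' r'r.
  by case: (r' =P r) r'r => // _ _; apply: p00.
have gens x : exists (l : 'I_n -> Fbar) t, x = \sum_j l j *: emb (tnth e j) + incl t.
  move: x; apply: (ext_ind (iota := iota)) => [|a y x [l [t ->]]].
    exists (fun=> 0), 0; rewrite (zmod_morph0 (zmod_morphism_linear incl_linear)) addr0.
    by rewrite big1 // => j _; rewrite scale0r.
  have [U [SU _ eU]] := he.
  have /memv_addP[s sS [u uU ->]] : y \in (S + U)%VS by rewrite SU memvf.
  exists (fun j => a * iota (coord e j u) + l j), (a *: emb (vsproj S s) + t).
  rewrite incl_linear incl_emb vsprojK // -[s + u]scale1r scalerDr.
  rewrite emb_linear scale1r rmorph1 scale1r (emb_coord _ eU uU).
  under [in RHS]eq_bigr do rewrite scalerDl -scalerA.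
  by rewrite big_split /= -scaler_sumr scalerDr [a *: emb s + _]addrC addrACA.
have spanS := @PBW_spanning Fbar p p1 (ext Fbar L) brL pmLb (char_ext c) (uL c) (gL c)
  (@red_genD _ _ _ _ _ _) (@red_genM _ _ _ _ _ _) (@red_genX _ _ _ _ _ _)
  (ext Fbar K) (Wc c) (ind c) cact incl (ipure c) pDl pZl ipure_incl
  n (fun j => emb (tnth e j)) gens P PD PZ Pmon.
apply: tensor_ind => // l a m; apply: (PZ l); move: m.
(* Passes from words to all of u(L,c). Q varies in the induction because a left factor x replaces Q
   by v |-> Q(x v). *)
have main (u : uL c) : forall Q : uL c -> Prop, (forall a b, Q a -> Q b -> Q (a + b)) ->
    (forall l a, Q a -> Q (alg_scal (uL c) l * a)) ->
    (forall s, Q (\prod_(x <- s) gL c x)) -> Q u.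
  elim/reduced_ind: u {l a} => [|u v ihu ihv|l u ih|x u ih] Q QD QZ Qs.
  - by have := Qs [::]; rewrite big_nil.
  - by apply: (QD u v); [exact: (ihu Q) | exact: (ihv Q)].
  - by apply: (QZ l u); exact: (ih Q).
  apply: (ih (fun v => Q (gL c x * v))) => [a b qa qb|l a qa|s].
  - by rewrite mulrDr; apply: QD.
  - by rewrite mulrA -alg_scalC -mulrA; apply: QZ.
  by have := Qs (x :: s); rewrite big_cons.
apply: (main a (fun a => forall m, P (ipure c a m))) => [a1 a2 h1 h2 m|l' a1 h1 m|s m].
- by rewrite pDl; apply: PD.
- by rewrite pZl; apply: PZ.
exact: spanS.
Qed.

End OneCharacter.

(** * The semilinear map attached to an automorphism *)

Section Twist.
Variables (alpha : {rmorphism Fbar -> Fbar}) (hal : galois_aut iota alpha).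
Variable c : L -> Fbar.
Hypothesis cc : is_character iota c.
Local Notation d := (alpha \o c).
Let amenable_at c' := forall w, w \in comp c' ->
  forall s, phi_ext iota p spm rho s w = c' (vsval s) ^+ p *: w.
Hypothesis cam : amenable_at c.
Hypothesis dam : amenable_at d.

Lemma twist_character : is_character iota d.
Proof.
move=> a x y; rewrite -[LHS]/(alpha (c (a *: x + y))) cc.
by rewrite rmorphD rmorphM hal.2.
Qed.
Let dc := twist_character.

Lemma map_ext_pm x : map_ext alpha (pmLb x) = pmLb (map_ext alpha x).
Proof.
apply: (pmap_compat (iota := iota) p0 (alpha := alpha) hLb.1 hLb.1).
- exact: map_extP.
- by move=> u v; apply: map_ext_bilin.
by move=> y; rewrite hLb.2 !(map_ext_emb hal) hLb.2.
Qed.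

Lemma map_ext_incl s : map_ext alpha (incl s) = incl (map_ext alpha s).
Proof.
move: s; apply: (ext_ind (iota := iota)) => [|a x s ih].
  by rewrite map_ext0 (zmod_morph0 (zmod_morphism_linear incl_linear)) map_ext0.
by rewrite incl_linear !map_extP incl_linear ih incl_emb !(map_ext_emb hal) incl_emb.
Qed.

Let g x : twisted_alg alpha (uL d) := gL d (map_ext alpha x).

Let gD a x y : g (a *: x + y) = alg_scal (twisted_alg alpha (uL d)) a * g x + g y.
Proof. by rewrite /g map_extP; apply: red_genD. Qed.

Let gbr x y : g (brL x y) = g x * g y - g y * g x.
Proof. by rewrite /g (map_ext_bilin hal) // [X in X - _]red_genM addrC addKr. Qed.

Let gpm x :
  g x ^+ p = g (pmLb x) + alg_scal (twisted_alg alpha (uL d)) (char_ext c x ^+ p).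
Proof.
rewrite /g map_ext_pm /= rmorphXn /= (map_char_ext alpha x cc); exact: red_genX.
Qed.

Definition twist_uL (u : uL c) : uL d :=
  reduced_hom (A := twisted_alg alpha (uL d)) (fun x => gL d (map_ext alpha x)) u.

Lemma twist_uL_gen x : twist_uL (gL c x) = gL d (map_ext alpha x).
Proof. exact: (reduced_hom_gen gD gbr gpm). Qed.

Lemma twist_uL_scal a : twist_uL (alg_scal (uL c) a) = alg_scal (uL d) (alpha a).
Proof. exact: (reduced_hom_scal gD gbr gpm). Qed.

Lemma twist_uLM u v : twist_uL (u * v) = twist_uL u * twist_uL v.
Proof. exact: (reduced_homM gD gbr gpm). Qed.

Lemma twist_uLD u v : twist_uL (u + v) = twist_uL u + twist_uL v.
Proof. exact: (zmod_morphD (reduced_homB gD gbr gpm)). Qed.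

Lemma twist_uL1 : twist_uL 1 = 1.
Proof. exact: (reduced_hom1 gD gbr gpm). Qed.

Lemma twist_PBW n (e : n.-tuple L) r :
  twist_uL (PBW_monomial iota br pmLb e c r) = PBW_monomial iota br pmLb e d r.
Proof.
rewrite /PBW_monomial (big_morph _ twist_uLM twist_uL1); apply: eq_bigr => j _.
elim: (nat_of_ord (r j)) => [|m ih]; first by rewrite !expr0 twist_uL1.
by rewrite !exprS twist_uLM ih twist_uL_gen (map_ext_emb hal).
Qed.

(** Coordinatewise alpha commutes with each s in S and sends c(s)^p to (alpha c)(s)^p, so it
    intertwines the two shifts. *)
Lemma map_ext_component w : w \in comp c -> map_ext alpha w \in comp d.
Proof.
have rb := lie_module_bilin hW.
move=> /asboolP[r hr]; apply/asboolP; exists r => s.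
have step u : phi_shift iota p spm rho (char_res S d) s (map_ext alpha u) =
    map_ext alpha (phi_shift iota p spm rho (char_res S c) s u).
  have mB (x y : ext Fbar W) : map_ext alpha (x - y) = map_ext alpha x - map_ext alpha y.
    by rewrite addrC -scaleN1r map_extP rmorphN1 scaleN1r addrC.
  have mZ a (x : ext Fbar W) : map_ext alpha (a *: x) = alpha a *: map_ext alpha x.
    by have := map_extP alpha a x 0; rewrite map_ext0 !addr0.
  have mr t (x : ext Fbar W) :
      rhob (emb t) (map_ext alpha x) = map_ext alpha (rhob (emb t) x).
    by rewrite (map_ext_bilin hal) // (map_ext_emb hal).
  rewrite /phi_shift /phi_ext /phi !mB mZ rmorphXn mr; congr (_ - _ - _).
  by elim: (p) => [//|m ih]; rewrite !iterS ih mr.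
have -> : iter r (phi_shift iota p spm rho (char_res S d) s) (map_ext alpha w) =
   map_ext alpha (iter r (phi_shift iota p spm rho (char_res S c) s) w).
  by elim: r {hr} => [//|r ih]; rewrite !iterS ih step.
by rewrite hr map_ext0.
Qed.

Definition twist_comp (w : Wc c) : Wc d := insubd (0 : Wc d) (map_ext alpha (comp_val w)).

Lemma twist_compE w : comp_val (twist_comp w) = map_ext alpha (comp_val w).
Proof. by apply/comp_val_insubd/map_ext_component/comp_valP. Qed.

Let G (a : uL c) (w : Wc c) : ind d := ipure d (twist_uL a) (twist_comp w).

Lemma twist_compP a v w :
  twist_comp (a *: v + w) = alpha a *: twist_comp v + twist_comp w.
Proof.
by apply: comp_val_inj; rewrite twist_compE !comp_val_linear !twist_compE map_extP.
Qed.

Let GDl a a' w : G (a + a') w = G a w + G a' w.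
Proof. by rewrite /G twist_uLD; apply: pureDl. Qed.

Let GDr a w w' : G a (w + w') = G a w + G a w'.
Proof.
rewrite /G; have := twist_compP 1 w w'; rewrite rmorph1 !scale1r => ->; exact: pureDr.
Qed.

Let GZl l a w : G (alg_scal (uL c) l * a) w = alpha l *: G a w.
Proof. by rewrite /G twist_uLM twist_uL_scal; apply: pureZl. Qed.

Let GZr l a w : G a (l *: w) = alpha l *: G a w.
Proof.
rewrite /G; have := twist_compP l w 0; rewrite !addr0.
have -> : twist_comp 0 = 0.
  by apply: comp_val_inj; rewrite twist_compE map_ext0.
rewrite addr0 => ->; exact: ipureZr.
Qed.

Let G_incl a s w : G (a * gL c (incl s)) w = G a (comp_act s w).
Proof.
have e : twist_uL (a * gL c (incl s)) = twist_uL a * gL d (incl (map_ext alpha s)).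
  by rewrite twist_uLM twist_uL_gen map_ext_incl.
rewrite /G e; apply: etrans (ipure_incl dc dam _ _ _) _; congr (ipure d _ _).
apply: comp_val_inj; rewrite comp_actE // !twist_compE comp_actE //.
by rewrite (map_ext_bilin hal) //; apply: lie_module_bilin hW.
Qed.

Local Notation fS := (@uS_to_uL F Fbar iota p L br S pmLb pmSb c).
Local Notation aS := (@uS_act F Fbar iota p L br pm S pmSb W rho c).

Let G_bal a (b : uS c) w : G (a * fS b) w = G a (aS b w).
Proof.
elim/reduced_ind: b a w => [|u v ihu ihv|l u ih|x u ih] a w.
- have -> : fS 1 = 1 by rewrite -(rmorph1 (alg_scal (uS c))) (uS_to_uL_scal cc) rmorph1.
  have -> : aS 1 w = w.
    by rewrite -(rmorph1 (alg_scal (uS c))) (uS_act_scal cc cam) scale1r.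
  by rewrite mulr1.
- have -> : fS (u + v) = fS u + fS v by exact: uS_to_uLD.
  have -> : aS (u + v) w = aS u w + aS v w by exact: uS_actD.
  rewrite mulrDr (GDl (a * fS u) (a * fS v) w) (GDr a (aS u w) (aS v w)).
  exact: (congr2 +%R (ihu a w) (ihv a w)).
- have -> : fS (alg_scal (uS c) l * u) = alg_scal (uL c) l * fS u.
    by rewrite -(uS_to_uL_scal cc); exact: uS_to_uLM.
  have -> : aS (alg_scal (uS c) l * u) w = l *: aS u w.
    by rewrite -(uS_act_scal cc cam); exact: uS_actM.
  by rewrite mulrA -alg_scalC -mulrA (GZl l (a * fS u) w) (GZr l a (aS u w));
     exact: (congr1 ( *:%R (alpha l)) (ih a w)).
set y := reduced_gen _ _ _ _ x.
have -> : fS (y * u) = gL c (incl x) * fS u.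
  by rewrite -(uS_to_uL_gen cc); exact: uS_to_uLM.
have -> : aS (y * u) w = comp_act x (aS u w).
  by rewrite -(uS_act_gen cc cam); exact: uS_actM.
by rewrite mulrA; exact: (etrans (ih (a * gL c (incl x)) w) (G_incl a x (aS u w))).
Qed.

Definition twist : ind c -> ind d := tensor_lift alpha G.

Let alphaB : zmod_morphism alpha. Proof. exact: rmorphB. Qed.
Let alphaM : {morph alpha : a b / a * b}. Proof. exact: rmorphM. Qed.

Lemma twist_pure a w : twist (ipure c a w) = ipure d (twist_uL a) (twist_comp w).
Proof. exact: (tensor_lift_pure alphaB alphaM (rmorph1 _) GDl GDr GZl G_bal). Qed.

Lemma twistB : zmod_morphism twist.
Proof. exact: (tensor_liftB alphaB alphaM (rmorph1 _) GDl GDr GZl G_bal). Qed.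

Lemma twistZ l t : twist (l *: t) = alpha l *: twist t.
Proof. exact: (tensor_liftZ alphaB alphaM (rmorph1 _) GDl GDr GZl G_bal). Qed.

(** Both sides are additive, and on a pure tensor [twist_uL] is multiplicative and fixes the
    generator of x, as x is rational. *)
Lemma twist_act x t : twist (induced_act (emb x) t) = induced_act (emb x) (twist t).
Proof.
have [aP aB aZ] := @tensor_act_spec _ _ _ _ (@uS_to_uL F Fbar iota p L br S pmLb pmSb c)
  (@uS_act F Fbar iota p L br pm S pmSb W rho c) (gL c (emb x)).
have [bP bB bZ] := @tensor_act_spec _ _ _ _ (@uS_to_uL F Fbar iota p L br S pmLb pmSb d)
  (@uS_act F Fbar iota p L br pm S pmSb W rho d) (gL d (emb x)).
move: t; apply: (@tensor_ext _ _ _ _ _ _ _ (fun t => twist (induced_act (emb x) t))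
    (fun t => induced_act (emb x) (twist t))) => [t u|t u|l a w].
- exact: etrans (congr1 twist (aB t u)) (twistB _ _).
- exact: etrans (congr1 (induced_act (emb x)) (twistB t u)) (bB _ _).
have lhs : twist (induced_act (emb x) (l *: ipure c a w)) =
    alpha l *: ipure d (twist_uL (gL c (emb x) * a)) (twist_comp w).
  apply: etrans (congr1 twist (aZ l (ipure c a w))) _; apply: etrans (twistZ _ _) _.
  apply: (congr1 ( *:%R (alpha l))); apply: etrans (congr1 twist (aP a w)) _.
  exact: twist_pure.
have rhs : induced_act (emb x) (twist (l *: ipure c a w)) =
    alpha l *: ipure d (gL d (emb x) * twist_uL a) (twist_comp w).
  apply: etrans (congr1 (induced_act (emb x)) (twistZ l (ipure c a w))) _.
  apply: etrans (bZ _ _) _; apply: (congr1 ( *:%R (alpha l))).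
  by apply: etrans (congr1 (induced_act (emb x)) (twist_pure a w)) _; apply: bP.
have e : twist_uL (gL c (emb x) * a) = gL d (emb x) * twist_uL a.
  by rewrite (twist_uLM _ a) (twist_uL_gen (emb x)) (map_ext_emb hal).
exact: etrans lhs (etrans (congr1 (fun b => _ *: ipure d b _) e) (esym rhs)).
Qed.

End Twist.

(** * Decomposition along the cluster, and invariance *)

Section Invariance.
Variable C : {fset (L -> Fbar)}.
Hypothesis hC : cluster iota C.
Hypothesis hCS : restricts_simply S C.
Hypothesis hWam : amenable iota p spm rho.
Hypothesis hCl : forall d : K -> Fbar, module_cluster iota p spm rho d <->
  exists2 c : L -> Fbar, c \in C & d = char_res S c.

Local Notation wcomp := (@W_components F Fbar iota p L pm S W rho C).

Let cC (c : C) : is_character iota (fsval c). Proof. exact/hC.1/fsvalP. Qed.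

Let amC (c : C) w : w \in comp (fsval c) ->
  forall s, phi_ext iota p spm rho s w = fsval c (vsval s) ^+ p *: w.
Proof.
apply: (hWam (c := char_res S (fsval c))); apply/hCl.
by exists (fsval c) => //; apply: fsvalP.
Qed.

(** Simple restriction makes the characters of S attached to the members of C distinct, so
    [component_uniq] applies. *)
Lemma family_uniq (z : C -> ext Fbar W) : (forall c, z c \in comp (fsval c)) ->
  \sum_c z c = 0 -> forall c, z c = 0.
Proof.
move=> zc z0 c; pose ch (c : C) := char_res S (fsval c).
have ch_inj : injective ch.
  move=> c1 c2 e; apply: val_inj; apply: hCS e; exact: fsvalP.
(* Reindexes z by characters of S; each nonempty fibre is a single point. *)
pose u f := \sum_(c | ch c == f) z c.
have uE c1 : u (ch c1) = z c1.
  rewrite /u (big_pred1 c1) // => c2; exact: (inj_eq ch_inj).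
rewrite -uE.
apply: (component_uniq pF sub_br_bilin hSb hW (l := [seq ch c | c <- index_enum C])).
- by rewrite map_inj_uniq // index_enum_uniq.
- by move=> _ /mapP[c1 _ ->]; apply/char_res_character/cC.
- by move=> _ /mapP[c1 _ ->]; rewrite uE; apply: zc.
- by rewrite big_map -[RHS]z0; apply: eq_bigr => c1 _; apply: uE.
by rewrite map_f // mem_index_enum.
Qed.

(** Existence comes from [component_decomp], since Cl(W) is the restriction of C; so [xget] does not
    return its default. *)
Lemma wcompE w : w = \sum_c comp_val (wcomp w c).
Proof.
suff : exists f : forall c : C, Wc (fsval c), w = \sum_c comp_val (f c).
  by move=> ex; apply: (xgetPex (fun c => 0) ex).
apply: (component_decomp pF ck sub_br_bilin hSb hW (D := fun w =>
  exists f : forall c : C, Wc (fsval c), w = \sum_c comp_val (f c))).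
- by exists (fun c => 0); rewrite big1.
- move=> u v [f ->] [g ->]; exists (fun c => f c + g c).
  by rewrite -big_split.
move=> d u /hCl[c cC' ->] uc; pose c0 : C := FSetSub cC'.
exists (fun c => insubd (0 : Wc (fsval c)) (if c == c0 then u else 0)).
rewrite (sum_single (i := c0)) => [|c1 /negbTE ->]; last first.
  by rewrite comp_val_insubd // rpred0.
by rewrite eqxx comp_val_insubd.
Qed.

Lemma wcomp_eq w (z : C -> ext Fbar W) : (forall c, z c \in comp (fsval c)) ->
  w = \sum_c z c -> forall c, comp_val (wcomp w c) = z c.
Proof.
move=> zc wz c; apply/eqP; rewrite -subr_eq0; apply/eqP.
apply: (family_uniq (z := fun c => comp_val (wcomp w c) - z c)) => [c1|].
  by apply: rpredB; [apply: comp_valP | apply: zc].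
by rewrite sumrB -wcompE -wz subrr.
Qed.

Lemma wcomp_linear c : linear (fun w => wcomp w c).
Proof.
move=> a u v; apply: comp_val_inj.
apply: (wcomp_eq (z := fun c => comp_val (a *: wcomp u c + wcomp v c))) => [c1|].
  exact: comp_valP.
rewrite {1}[u]wcompE {1}[v]wcompE scaler_sumr -big_split.
by apply: eq_bigr => c1 _; rewrite comp_val_linear.
Qed.

Variables (n m : nat) (e : n.-tuple L) (b : m.-tuple W).
Hypothesis he : cobasis S e.
Hypothesis hb : basis_of fullv b.

Local Notation comb := (@PBW_comb F Fbar iota p L br pm S pmLb pmSb W rho C n m e b).
Local Notation V := (@Vbar F Fbar iota p L br pm S pmLb pmSb W rho C).

Lemma comb_spanning (v : V) : exists lam, v = comb lam.
Proof.
have vP (c : C) : exists w : {ffun 'I_n -> 'I_p} -> Wc (fsval c),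
    v c = \sum_r ipure (fsval c) (PBW_monomial iota br pmLb e (fsval c) r) (w r).
  by apply: ipure_spanning => //; apply: amC.
pose w (c : C) := sval (cid (vP c)).
have vw c : v c =
    \sum_r ipure (fsval c) (PBW_monomial iota br pmLb e (fsval c) r) (w c r).
  exact: (svalP (cid (vP c))).
have bW (u : ext Fbar W) : exists l : 'I_m -> Fbar, u = \sum_i l i *: emb (tnth b i).
  move: u; apply: (ext_ind (iota := iota)) => [|a x u [l ->]].
    by exists (fun=> 0); rewrite big1 // => i _; rewrite scale0r.
  exists (fun i => a * iota (coord b i x) + l i).
  rewrite (emb_coord _ hb (memvf x)) scaler_sumr -big_split; apply: eq_bigr => i _.
  by rewrite scalerDl scalerA.
(* One family of coefficients must serve all c at once: the w_(c,r) are glued into one vector of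
   Fbar (x) W, expanded in the basis b, and recovered as its components. *)
have /choice[lam lamP] := fun r => bW (\sum_c comp_val (w c r)).
exists lam; apply: functional_extensionality_dep => c.
apply: etrans (vw c) _; apply: eq_bigr => r _.
set a := PBW_monomial _ _ _ _ _ _.
have -> : w c r = \sum_i lam r i *: wcomp (emb (tnth b i)) c.
  apply: comp_val_inj.
  apply: etrans (esym (wcomp_eq (z := fun c => comp_val (w c r)) _ (esym (lamP r)) c)) _.
    by move=> c1; apply: comp_valP.
  congr comp_val; elim: (index_enum _) => [|i s ih].
    by rewrite !big_nil (zmod_morph0 (zmod_morphism_linear (wcomp_linear c))).
  by rewrite !big_cons [LHS]wcomp_linear ih.
elim: (index_enum _) => [|i s ih].
  by rewrite !big_nil -(scale0r 0) (ipureZr (cC c) (@amC c)) scale0r.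
rewrite !big_cons [LHS]pureDr; apply: (congr2 +%R _ ih).
exact: (ipureZr (cC c) (@amC c)).
Qed.

Section Galois.
Variables (alpha : {rmorphism Fbar -> Fbar}) (hal : galois_aut iota alpha).

Definition conj_index (c : C) : C := FSetSub (hC.2 alpha _ hal (fsvalP c)).

Lemma conj_index_inj : injective conj_index.
Proof.
move=> c1 c2 /(congr1 val) /= e12; apply: val_inj; apply/funext => x.
by apply: (fmorph_inj alpha); apply: (congr1 (fun f => f x) e12).
Qed.

Let amD (c : C) : forall w, w \in comp (alpha \o fsval c) ->
  forall s, phi_ext iota p spm rho s w = (alpha \o fsval c) (vsval s) ^+ p *: w.
Proof. exact: (@amC (conj_index c)). Qed.

(** Applying alpha to the decomposition of the fixed vector [emb x] gives another decomposition,
    permuted by c |-> alpha c; uniqueness identifies the two. *)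
Lemma wcomp_twist x c :
  twist_comp (c := fsval c) alpha (wcomp (emb x) c) = wcomp (emb x) (conj_index c).
Proof.
pose z (c' : C) := map_ext alpha (comp_val (wcomp (emb x) (invF conj_index_inj c'))).
have zE c1 : z (conj_index c1) = map_ext alpha (comp_val (wcomp (emb x) c1)).
  by rewrite /z invF_f.
apply: comp_val_inj; rewrite twist_compE // -zE; apply/esym.
apply: wcomp_eq => [c1|].
  rewrite -(f_invF conj_index_inj c1) zE; exact/map_ext_component/comp_valP.
rewrite (reindex_inj conj_index_inj) /=; under eq_bigr do rewrite zE.
rewrite -{1}(map_ext_emb hal x) {1}[emb x]wcompE.
elim: (index_enum _) => [|c1 s ih]; first by rewrite !big_nil map_ext0.
by rewrite !big_cons -ih -[comp_val _]scale1r map_extP rmorph1 !scale1r.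
Qed.

Lemma comb_twist lam c :
  comb (fun r i => alpha (lam r i)) (conj_index c) = twist alpha (comb lam c).
Proof.
have tB := twistB hal (cC c) (@amC c) (@amD c).
have tZ := twistZ hal (cC c) (@amC c) (@amD c).
have tP := twist_pure hal (cC c) (@amC c) (@amD c).
rewrite /PBW_comb (zmod_morph_sum _ _ _ tB); apply: eq_bigr => r _.
rewrite (zmod_morph_sum _ _ _ tB); apply: eq_bigr => i _.
rewrite tZ; apply: (congr1 ( *:%R _)); apply: etrans _ (esym (tP _ _)).
by rewrite wcomp_twist (twist_PBW hal).
Qed.

End Galois.

Lemma galois_invariant_act (v : V) x : galois_invariant e b v ->
  galois_invariant e b (Vbar_act (emb x) v).
Proof.
move=> hv alpha hal; have [lam v1 v2] := hv alpha hal.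
have [lam' xv] := comb_spanning (Vbar_act (emb x) v).
exists lam'; first exact: xv.
apply: functional_extensionality_dep => c'.
rewrite -(f_invF (@conj_index_inj alpha hal) c'); move: (invF _ c') => c.
have tA := twist_act hal (cC c) (@amC c) (@amC (conj_index hal c)) x (v c).
(* Both expressions for v supplied by invariance use the same coefficients, up to alpha. *)
have e1 : v (conj_index hal c) = twist alpha (v c).
  rewrite {1}v2 {1}v1; exact: comb_twist.
apply: etrans (congr1 (induced_act (emb x)) e1) _; apply: etrans (esym tA) _.
rewrite -[induced_act _ _]/(Vbar_act (emb x) v c) xv; exact/esym/comb_twist.
Qed.

End Invariance.
End Induced.

Theorem lemma6p5 (F Fbar : fieldType) (iota : {rmorphism F -> Fbar}) (p : nat)
    (hp : p \in [pchar F]) (hF : perfect F p)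
    (hFbar : algebraic_closure iota)
    (L : vectType F) (br : L -> L -> L) (pm : L -> L)
    (hL : restricted_lie p br pm)
    (pmLb : ext Fbar L -> ext Fbar L) (hLb : is_ext_pmap iota p br pm pmLb)
    (S : {vspace L}) (hS : p_subalgebra br pm S)
    (pmSb : ext Fbar (subvs_of S) -> ext Fbar (subvs_of S))
    (hSb : is_ext_pmap iota p (sub_br br S) (sub_pm pm S) pmSb)
    (C : {fset (L -> Fbar)})
    (hC : simple_cluster iota C) (hCS : restricts_simply S C)
    (W : vectType F) (rho : subvs_of S -> W -> W)
    (hW : lie_module (sub_br br S) rho)
    (hWam : amenable iota p (sub_pm pm S) rho)
    (hCl : forall d : subvs_of S -> Fbar,
       module_cluster iota p (sub_pm pm S) rho d <->
       exists2 c : L -> Fbar, c \in C & d = char_res S c)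
    (n m : nat) (e : n.-tuple L) (he : cobasis S e)
    (b : m.-tuple W) (hb : basis_of fullv b)
    (v : Vbar iota p br pm pmLb pmSb rho C)
    (hv : galois_invariant e b v) (x : L) :
  galois_invariant e b (Vbar_act (emb iota x) v).
Proof.
exact: (galois_invariant_act hp hFbar.1 hL hLb hS hSb hW (proj1 hC) hCS hWam hCl he hb x hv).
Qed.
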